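(* Consider the homogeneous space $\mathbb{S}^7=\mathrm{Sp}(2)/\mathrm{Sp}(1)$ with the reductive decomposition $\mathfrak{sp}(2)=\mathfrak{sp}(1)\oplus\mathfrak{p}$. The $\mathrm{Ad}(\mathrm{Sp}(1))$-invariant $\mathrm{G}_2$-structures on $\mathfrak{p}$ have the form $$\varphi=a^3e^{123}+(\alpha_1e^1+\alpha_2e^2+\alpha_3e^3)\wedge\omega_1+(\beta_1e^1+\beta_2e^2+\beta_3e^3)\wedge\omega_2+(\gamma_1e^1+\gamma_2e^2+\gamma_3e^3)\wedge\omega_3,$$ the coefficients of which satisfy $$a\cdot\det D^{-1}>0,\qquad D^{-1}:=\begin{pmatrix}\alpha_1&\alpha_2&\alpha_3\\\beta_1&\beta_2&\beta_3\\\gamma_1&\gamma_2&\gamma_3\end{pmatrix}.$$ Moreover, the $\mathrm{Ad}(\mathrm{Sp}(1))$-invariant inner product on $\mathfrak{p}$ induced by $\varphi$ is given, in the basis $e_1,\dots,e_7$, by $$g=\frac{a^2}{\det(D^{-1})^{2/3}}\begin{pmatrix}(DD^t)^{-1}&0\\0&\frac{\det(D^{-1})}{a^3}I_{4\times4}\end{pmatrix},$$ and the induced orientation is parametrised by $a\in\mathbb{R}\smallsetminus\{0\}$ (i.e. by its sign). In particular, $n_{\mathrm{G}_2}=10$ and $n_{\mathrm{O}(7)}=7$.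
   Context: $\mathfrak{sp}(2)=\{A\in\mathfrak{gl}(2,\mathbb{H}):A+A^*=0\}$; $\mathrm{Sp}(1)\subset\mathrm{Sp}(2)$ via $h\mapsto\mathrm{diag}(h,1)$; $\mathfrak{p}=\mathfrak{sp}(1)^\perp$ with respect to $\langle A_1,A_2\rangle=\mathrm{Re}\,\mathrm{tr}(A_1A_2^* )$, with basis $e_1=\mathrm{diag}(0,i)$, $e_2=\mathrm{diag}(0,j)$, $e_3=\mathrm{diag}(0,k)$, $e_4=\frac1{\sqrt2}\begin{pmatrix}0&i\\ i&0\end{pmatrix}$, $e_5=\frac1{\sqrt2}\begin{pmatrix}0&j\\ j&0\end{pmatrix}$, $e_6=\frac1{\sqrt2}\begin{pmatrix}0&k\\ k&0\end{pmatrix}$, $e_7=\frac1{\sqrt2}\begin{pmatrix}0&1\\-1&0\end{pmatrix}$, dual basis $e^i$, $e^{ij\cdots}=e^i\wedge e^j\wedge\cdots$; $\omega_1=e^{47}+e^{56}$, $\omega_2=e^{46}-e^{57}$, $\omega_3=e^{45}+e^{67}$. A $\mathrm{G}_2$-structure on $\mathfrak{p}$ is a $3$-form $\varphi$ whose symmetric bilinear form $B_{ij}=\big((e_i\lrcorner\varphi)\wedge(e_j\lrcorner\varphi)\wedge\varphi\big)(e_1,\dots,e_7)$ is definite; the induced inner product is $g_{ij}=6^{-2/9}B_{ij}/\det(B)^{1/9}$ and the induced orientation is the one with $B$ positive for an oriented basis. $n_{\mathrm{G}_2}$ is the dimension of the space of $\mathrm{Sp}(2)$-invariant $\mathrm{G}_2$-structures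 on $\mathbb{S}^7$ (equivalently $\mathrm{Ad}(\mathrm{Sp}(1))$-invariant $\mathrm{G}_2$-structures on $\mathfrak{p}$), and $n_{\mathrm{O}(7)}$ is the dimension of the space of $\mathrm{Sp}(2)$-invariant Riemannian metrics induced by them. *)

(* Defs.v *)
From HB Require Import structures.
From mathcomp Require Import all_boot all_order all_algebra perm.
From mathcomp Require Import ring lra.
From mathcomp Require Import mathcomp_extra boolp classical_sets functions.
From mathcomp Require Import reals topology normedtype derive exp.

Set Implicit Arguments.
Unset Strict Implicit.
Unset Printing Implicit Defensive.

Import Order.TTheory GRing.Theory Num.Theory.
Import numFieldNormedType.Exports.

Local Open Scope classical_set_scope.
Local Open Scope ring_scope.

Record quat (R : realType) := Quat { qre : R; qi : R; qj : R; qk : R }.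

Section Quaternions.
Variable R : realType.
Implicit Types (p q r : quat R) (t : R).

Let prod_of_quat q : R * R * R * R := (qre q, qi q, qj q, qk q).
Let quat_of_prod (x : R * R * R * R) : quat R :=
  Quat x.1.1.1 x.1.1.2 x.1.2 x.2.
Let prod_of_quatK : cancel prod_of_quat quat_of_prod.
Proof. by case. Qed.

HB.instance Definition _ := Choice.copy (quat R) (can_type prod_of_quatK).

Lemma quat_ext p q :
  qre p = qre q -> qi p = qi q -> qj p = qj q -> qk p = qk q -> p = q.
Proof. by case: p q => [????] [????] /= -> -> -> ->. Qed.

Definition quat_add p q :=
  Quat (qre p + qre q) (qi p + qi q) (qj p + qj q) (qk p + qk q).
Definition quat_opp p := Quat (- qre p) (- qi p) (- qj p) (- qk p).
Definition quat_mul p q :=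
  Quat (qre p * qre q - qi p * qi q - qj p * qj q - qk p * qk q)
       (qre p * qi q + qi p * qre q + qj p * qk q - qk p * qj q)
       (qre p * qj q - qi p * qk q + qj p * qre q + qk p * qi q)
       (qre p * qk q + qi p * qj q - qj p * qi q + qk p * qre q).
Definition quat_scale t p := Quat (t * qre p) (t * qi p) (t * qj p) (t * qk p).

Let quat_addA : associative quat_add.
Proof. by move=> p q r; apply: quat_ext => /=; ring. Qed.
Let quat_addC : commutative quat_add.
Proof. by move=> p q; apply: quat_ext => /=; ring. Qed.
Let quat_add0 : left_id (Quat 0 0 0 0) quat_add.
Proof. by move=> p; apply: quat_ext => /=; ring. Qed.
Let quat_addN : left_inverse (Quat 0 0 0 0) quat_opp quat_add.
Proof. by move=> p; apply: quat_ext => /=; ring. Qed.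
HB.instance Definition _ := GRing.isZmodule.Build (quat R)
  quat_addA quat_addC quat_add0 quat_addN.

Let quat_mulA : associative quat_mul.
Proof. by move=> p q r; apply: quat_ext => /=; ring. Qed.
Let quat_mul1 : left_id (Quat 1 0 0 0) quat_mul.
Proof. by move=> p; apply: quat_ext => /=; ring. Qed.
Let quat_mulr1 : right_id (Quat 1 0 0 0) quat_mul.
Proof. by move=> p; apply: quat_ext => /=; ring. Qed.
Let quat_mulDl : left_distributive quat_mul +%R.
Proof. by move=> p q r; apply: quat_ext => /=; ring. Qed.
Let quat_mulDr : right_distributive quat_mul +%R.
Proof. by move=> p q r; apply: quat_ext => /=; ring. Qed.
Let quat_1neq0 : Quat 1 0 0 0 != 0 :> quat R.
Proof. by apply/eqP => -[] /eqP; rewrite oner_eq0. Qed.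
HB.instance Definition _ := GRing.Zmodule_isNzRing.Build (quat R)
  quat_mulA quat_mul1 quat_mulr1 quat_mulDl quat_mulDr quat_1neq0.

Let quat_scaleA a b p : quat_scale a (quat_scale b p) = quat_scale (a * b) p.
Proof. by apply: quat_ext => /=; ring. Qed.
Let quat_scale1 : left_id 1 quat_scale.
Proof. by move=> p; apply: quat_ext => /=; ring. Qed.
Let quat_scaleDr : right_distributive quat_scale +%R.
Proof. by move=> a p q; apply: quat_ext => /=; ring. Qed.
Let quat_scaleDl p : {morph quat_scale^~ p : a b / a + b}.
Proof. by move=> a b; apply: quat_ext => /=; ring. Qed.
HB.instance Definition _ := GRing.Zmodule_isLmodule.Build R (quat R)
  quat_scaleA quat_scale1 quat_scaleDr quat_scaleDl.

Definition quat_conj q : quat R := Quat (qre q) (- qi q) (- qj q) (- qk q).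

Definition quat_i : quat R := Quat 0 1 0 0.
Definition quat_j : quat R := Quat 0 0 1 0.
Definition quat_k : quat R := Quat 0 0 0 1.

Lemma quatD p q : p + q = quat_add p q. Proof. by []. Qed.
Lemma quatN p : - p = quat_opp p. Proof. by []. Qed.
Lemma quatM p q : p * q = quat_mul p q. Proof. by []. Qed.
Lemma quatZ t p : t *: p = quat_scale t p. Proof. by []. Qed.
Lemma quat0 : 0 = Quat 0 0 0 0 :> quat R. Proof. by []. Qed.
Lemma quat1 : 1 = Quat 1 0 0 0 :> quat R. Proof. by []. Qed.

End Quaternions.

Definition quatE := (quatD, quatN, quatM, quatZ, quat0, quat1).

(* The alias carries the real scalar multiplication; the module structure that
   'M[quat R]_2 already has is over the noncommutative ring quat R. *)
Definition gl2 (R : realType) : Type := 'M[quat R]_2.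

Section Gl2.
Variable R : realType.
Implicit Types (A B : gl2 R) (t : R).

HB.instance Definition _ := GRing.Zmodule.copy (gl2 R) 'M[quat R]_2.

Definition gl2_scale t A : gl2 R := \matrix_(i, j) (t *: A i j).

Let gl2_scaleA a b A : gl2_scale a (gl2_scale b A) = gl2_scale (a * b) A.
Proof. by apply/matrixP => i j; rewrite !mxE scalerA. Qed.
Let gl2_scale1 : left_id 1 gl2_scale.
Proof. by move=> A; apply/matrixP => i j; rewrite !mxE scale1r. Qed.
Let gl2_scaleDr : right_distributive gl2_scale +%R.
Proof. by move=> a A B; apply/matrixP => i j; rewrite !mxE scalerDr. Qed.
Let gl2_scaleDl A : {morph gl2_scale^~ A : a b / a + b}.
Proof. by move=> a b; apply/matrixP => i j; rewrite !mxE scalerDl. Qed.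
HB.instance Definition _ := GRing.Zmodule_isLmodule.Build R (gl2 R)
  gl2_scaleA gl2_scale1 gl2_scaleDr gl2_scaleDl.

Definition gl2_mul A B : gl2 R := (A : 'M[quat R]_2) *m B.

Definition gl2_star A : gl2 R := \matrix_(i, j) quat_conj (A j i).

Definition gl2_ip A B : R := qre (\tr (gl2_mul A (gl2_star B))).

Definition mx22 (a b c d : quat R) : gl2 R :=
  \matrix_(i, j) if i == 0 then (if j == 0 then a else b)
                 else (if j == 0 then c else d).

Definition sp2 : set (gl2 R) := [set A | A + gl2_star A = 0].

(* Lie algebra of the image of h |-> diag(h, 1). *)
Definition sp1 : set (gl2 R) :=
  [set mx22 x 0 0 0 | x in [set x : quat R | x + quat_conj x = 0]].

Definition p_pred : {pred gl2 R} :=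
  [pred A | `[< sp2 A /\ forall B, sp1 B -> gl2_ip A B = 0 >]].

Lemma gl2_ext A B :
  A 0 0 = B 0 0 -> A 0 1 = B 0 1 -> A 1 0 = B 1 0 -> A 1 1 = B 1 1 -> A = B.
Proof.
move=> h00 h01 h10 h11; apply/matrixP => i j.
have I2 (k : 'I_2) : k = 0 \/ k = 1.
  by case: k => [[|[|k]] hk] //; [left|right]; apply/val_inj.
by case: (I2 i) => ->; case: (I2 j) => ->.
Qed.

Lemma gl2_ipE A B : gl2_ip A B =
    qre (A 0 0 * quat_conj (B 0 0)) + qre (A 0 1 * quat_conj (B 0 1))
  + qre (A 1 0 * quat_conj (B 1 0)) + qre (A 1 1 * quat_conj (B 1 1)).
Proof.
rewrite /gl2_ip /mxtrace !big_ord_recl big_ord0 /gl2_mul /gl2_star !mxE.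
rewrite !big_ord_recl !big_ord0 !mxE.
rewrite (_ : lift ord0 ord0 = 1 :> 'I_2); last exact/val_inj.
by rewrite -[ord0]/(0 : 'I_2) !addr0 !quatD /= !addrA.
Qed.

Lemma p_predP A : reflect
  [/\ A 0 0 = 0, A 1 0 = - quat_conj (A 0 1) & qre (A 1 1) = 0]
  (A \in p_pred).
Proof.
apply: (iffP (asboolP _)) => [[skA orthA]|[A00 A10 A11]].
  have h i j : A i j = - quat_conj (A j i).
    by apply/eqP; rewrite -addr_eq0; have /matrixP/(_ i j) := skA; rewrite !mxE => /eqP.
  have imx a b c : a * qi (A 0 0) + b * qj (A 0 0) + c * qk (A 0 0) = 0.
    have hx : Quat 0 a b c + quat_conj (Quat 0 a b c) = 0.
      by apply: quat_ext; rewrite ?quatE /=; ring.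
    have := orthA (mx22 (Quat 0 a b c) 0 0 0) (ex_intro2 _ _ _ hx erefl).
    by rewrite gl2_ipE !mxE /= ?quatE /=; lra.
  split; [|exact: h|].
  - have /(congr1 (@qre R)) := h 0 0; rewrite ?quatE /= => hr.
    have := imx 1 0 0; have := imx 0 1 0; have := imx 0 0 1 => hk hj hi.
    by apply: quat_ext => /=; lra.
  - by have /(congr1 (@qre R)) := h 1 1; rewrite ?quatE /=; lra.
split.
  apply: gl2_ext; rewrite !mxE ?A00 ?A10;
    by apply: quat_ext; rewrite ?quatE /=; rewrite ?A11; ring.
move=> B [x /= _ <-]; rewrite gl2_ipE !mxE /= A00.
by rewrite ?quatE /=; ring.
Qed.

Lemma p_pred_submod : submod_closed p_pred.
Proof.
split; first by apply/p_predP; split; rewrite !mxE ?quatE //=;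
  apply: quat_ext => /=; ring.
move=> t A B /p_predP[a1 a2 a3] /p_predP[b1 b2 b3]; apply/p_predP.
split; rewrite !mxE ?a1 ?a2 ?b1 ?b2 ?quatE /= ?a3 ?b3; last by ring.
all: by apply: quat_ext => /=; ring.
Qed.
HB.instance Definition _ :=
  GRing.isSubmodClosed.Build R (gl2 R) p_pred p_pred_submod.

End Gl2.

Arguments p_pred R : clear implicits.

Record pspace (R : realType) :=
  Pspace { p_val :> gl2 R; p_valP : p_val \in p_pred R }.

HB.instance Definition _ (R : realType) := [isSub for @p_val R].
HB.instance Definition _ (R : realType) := [Choice of pspace R by <:].
HB.instance Definition _ (R : realType) :=
  [SubChoice_isSubLmodule of pspace R by <:].

Record Sp1 (R : realType) :=
  MkSp1 { sp1_val :> quat R; sp1_valP : sp1_val * quat_conj sp1_val = 1 }.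

Section Reductive.
Variable R : realType.
Implicit Types (u v : pspace R) (h : Sp1 R).

Definition Sp1_in_Sp2 h : gl2 R := mx22 (h : quat R) 0 0 1.

(* The inverse of an element g of Sp(2) is g^*. *)
Definition Ad_val h (A : gl2 R) : gl2 R :=
  gl2_mul (gl2_mul (Sp1_in_Sp2 h) A) (gl2_star (Sp1_in_Sp2 h)).

Lemma Ad_valE h A : Ad_val h A =
  let q : quat R := h in
  mx22 (q * A 0 0 * quat_conj q) (q * A 0 1) (A 1 0 * quat_conj q) (A 1 1).
Proof.
have l1 : lift ord0 ord0 = 1 :> 'I_2 by exact/val_inj.
have c1 : quat_conj 1 = 1 :> quat R by apply: quat_ext => //=; rewrite oppr0.
have c0 : quat_conj 0 = 0 :> quat R by apply: quat_ext => //=; rewrite oppr0.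
by apply: gl2_ext; rewrite !mxE /= !big_ord_recl !big_ord0 !mxE /=
  !big_ord_recl !big_ord0 !mxE /= !l1 ?c1 ?c0
  ?(mul0r, mulr0, mul1r, mulr1, addr0, add0r).
Qed.

Lemma Ad_subproof h u : Ad_val h u \in p_pred R.
Proof.
have /p_predP[u00 u10 u11] := p_valP u; apply/p_predP.
rewrite Ad_valE; split; rewrite !mxE /=.
- by rewrite u00 mulr0 mul0r.
- by rewrite u10; apply: quat_ext; rewrite ?quatE /=; ring.
- exact: u11.
Qed.

Definition Ad h u : pspace R := Pspace (Ad_subproof h u).

Definition isqrt2 : R := (Num.sqrt 2)^-1.

Lemma isqrt2E : 2 * isqrt2 * isqrt2 = 1.
Proof. by rewrite /isqrt2 -mulrA -invfM -expr2 sqr_sqrtr ?ler0n // divff ?pnatr_eq0. Qed.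

Definition e_val (i : 'I_7) : gl2 R :=
  tnth [tuple mx22 0 0 0 (quat_i R); mx22 0 0 0 (quat_j R);
              mx22 0 0 0 (quat_k R);
              isqrt2 *: mx22 0 (quat_i R) (quat_i R) 0;
              isqrt2 *: mx22 0 (quat_j R) (quat_j R) 0;
              isqrt2 *: mx22 0 (quat_k R) (quat_k R) 0;
              isqrt2 *: mx22 0 1 (-1) 0] i.

Lemma e_subproof i : e_val i \in p_pred R.
Proof.
case: i => [[|[|[|[|[|[|[|//]]]]]]] hi] //; apply/p_predP; split;
  rewrite /e_val /tnth /= ?mxE /= ?mxE /= ?quatE /=;
  by [ring | apply: quat_ext => /=; ring].
Qed.

(* [e i] is the i+1-st vector of the usual 1-based numbering. *)
Definition e (i : 'I_7) : pspace R := Pspace (e_subproof i).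

(* The dual basis: as [e] is orthonormal, the i-th coordinate is the inner
   product with [e i]; [ecoord_e] and [ecoord_sum] show that this is the dual
   basis, and that [e] is a basis. *)
Definition ecoord (i : 'I_7) u : R := gl2_ip u (e i).

Lemma ecoordE u i : ecoord i u =
  tnth [tuple qi (p_val u 1 1); qj (p_val u 1 1); qk (p_val u 1 1);
              2 * isqrt2 * qi (p_val u 0 1); 2 * isqrt2 * qj (p_val u 0 1);
              2 * isqrt2 * qk (p_val u 0 1); 2 * isqrt2 * qre (p_val u 0 1)] i.
Proof.
have /p_predP[u00 u10 u11] := p_valP u.
rewrite /ecoord gl2_ipE u00 u10 -[p_val (e i)]/(e_val i) /e_val.
move: isqrt2 => r.
by case: i => [[|[|[|[|[|[|[|//]]]]]]] hi]; rewrite /tnth /= !mxE /= ?mxE /= ?u11; ring.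
Qed.

Lemma ecoord_e i j : ecoord i (e j) = (i == j)%:R.
Proof.
rewrite ecoordE -[p_val (e j)]/(e_val j) /e_val.
have := isqrt2E; move: isqrt2 => r rE.
case: j => [[|[|[|[|[|[|[|//]]]]]]] hj]; rewrite !(tnth_nth 0) /= !mxE /= ?mxE /=
  ?(mulr0, mulr1, oppr0) ?rE; by case: i => [[|[|[|[|[|[|[|//]]]]]]] hi].
Qed.

Lemma ecoord_sum u : u = \sum_i ecoord i u *: e i.
Proof.
have /p_predP[u00 u10 u11] := p_valP u.
apply: val_inj; rewrite raddf_sum /= (eq_bigr (fun i => ecoord i u *: e_val i)) //.
rewrite !big_ord_recl big_ord0 !ecoordE /e_val /tnth /=.
have := isqrt2E; move: isqrt2 => r rE.
have K (x : R) : 2 * r * x * r = x by rewrite mulrAC rE mul1r.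
by apply: gl2_ext; rewrite ?mxE /= ?mxE /= ?mxE /= ?u00 ?u10;
  apply: quat_ext; rewrite ?quatE /= ?u11 ?(mulr0, mul0r, mulr1, mulrN, addr0, add0r, oppr0, opprK)
    ?K ?mulrA ?K ?opprK.
Qed.
End Reductive.

Section Forms.
Variables (R : realType) (V : lmodType R).

Definition kform (k : nat) : Type := ('I_k -> V) -> R.

Definition multilinear k (w : kform k) := forall (v : 'I_k -> V) i t x y,
  w (dfwith v i (t *: x + y)) = t * w (dfwith v i x) + w (dfwith v i y).

Definition alternating k (w : kform k) :=
  forall (v : 'I_k -> V) i j, i != j -> v i = v j -> w v = 0.

Definition is_kform k (w : kform k) := multilinear w /\ alternating w.

(* Normalised so that (e^1 /\ ... /\ e^n)(e_1, ..., e_n) = 1. *)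
Definition kwedge k l (w : kform k) (z : kform l) : kform (k + l) := fun v =>
  (k`! * l`!)%:R^-1 * \sum_(s : 'S_(k + l)) (-1) ^+ s *
    (w (fun i => v (s (lshift l i))) * z (fun j => v (s (rshift k j)))).

Definition kinterior k (x : V) (w : kform k.+1) : kform k := fun v =>
  w (fun i => if unlift ord0 i is Some j then v j else x).

Definition is_vbasis n (b : 'I_n -> V) :=
  forall x, exists! c : 'rV[R]_n, x = \sum_i c 0 i *: b i.

End Forms.

Arguments kform {R} V k.

Section Definite.
Variable R : realType.

Definition posdef_mx n (A : 'M[R]_n) :=
  forall x : 'rV[R]_n, x != 0 -> 0 < (x *m A *m x^T) 0 0.

Definition definite_mx n (A : 'M[R]_n) := posdef_mx A \/ posdef_mx (- A).

(* The real n-th root for odd n, negative on negative numbers. *)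
Definition oddroot (n : nat) (x : R) : R := Num.sg x * `|x| `^ n%:R^-1.

End Definite.

Section G2.
Variable R : realType.
Let p := pspace R.
Implicit Types (phi : kform p 3) (g : 'M[R]_7).

Definition Ad_invariant k (w : kform p k) :=
  forall (h : Sp1 R) (v : 'I_k -> p), w (fun i => Ad h (v i)) = w v.

(* The defining form of a G2-structure; [b] is needed because the 7-form is
   identified with a number by evaluating it on a basis. *)
Definition G2_bilin_mx phi (b : 'I_7 -> p) : 'M[R]_7 := \matrix_(i, j)
  kwedge (kwedge (kinterior (b i) phi) (kinterior (b j) phi)) phi b.

Definition G2_structure phi := is_kform phi /\ definite_mx (G2_bilin_mx phi (@e R)).

Definition invariant_G2_structures : set (kform p 3) :=
  [set phi | G2_structure phi /\ Ad_invariant phi].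

(* The matrix of the induced inner product in the basis [e]. *)
Definition G2_metric phi : 'M[R]_7 :=
  let B := G2_bilin_mx phi (@e R) in (6 `^ (- (2 / 9)) / oddroot 9 (\det B)) *: B.

(* [b] is a positive basis for the orientation induced by [phi]. *)
Definition G2_oriented phi (b : 'I_7 -> p) := is_vbasis b /\ posdef_mx (G2_bilin_mx phi b).

Definition bilin_mx g (u v : p) : R :=
  \sum_i \sum_j ecoord i u * g i j * ecoord j v.

(* [g] is the Gram matrix of an inner product in the basis [e]. *)
Definition invariant_inner_product g :=
  [/\ g^T = g, posdef_mx g &
      forall (h : Sp1 R) (u v : p), bilin_mx g (Ad h u) (Ad h v) = bilin_mx g u v].

(* e^n in the 1-based numbering, 1 <= n <= 7. *)
Definition de (n : nat) : kform p 1 := fun v => ecoord (inord n.-1) (v ord0).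

Local Notation "x '/*\' y" := (kwedge x y) (at level 40, left associativity).

Definition omega1 : kform p 2 := de 4 /*\ de 7 + de 5 /*\ de 6.
Definition omega2 : kform p 2 := de 4 /*\ de 6 - de 5 /*\ de 7.
Definition omega3 : kform p 2 := de 4 /*\ de 5 + de 6 /*\ de 7.

(* The rows of [M] are the coefficients alpha, beta and gamma. *)
Definition G2_form (a : R) (M : 'M[R]_3) : kform p 3 :=
  let row_form (r : 'I_3) : kform p 1 := \sum_(i < 3) M r i *: de i.+1 in
  a ^+ 3 *: (de 1 /*\ de 2 /*\ de 3 : kform p 3)
  + (row_form 0 /*\ omega1) + (row_form 1 /*\ omega2)
  + (row_form 2 /*\ omega3).

Definition coord_mx (b : 'I_7 -> p) : 'M[R]_7 :=
  \matrix_(i, j) ecoord j (b i).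

(* Components of a form in the basis [e], an injective linear map on forms that
   places the space of k-forms in a normed space. *)
Definition kform_components k (w : kform p k) : 'rV[R]_#|{ffun 'I_k -> 'I_7}| :=
  \row_s w (fun i => e R ((enum_val s : {ffun 'I_k -> 'I_7}) i)).

End G2.

Section Dimension.
Variable R : realType.

(* C^k regularity on an open set through directional derivatives: meant for
   finite-dimensional [V]. *)
Fixpoint C_k (k : nat) (V W : normedModType R) (U : set V) (f : V -> W) : Prop :=
  if k is k'.+1 then
    (forall x, U x -> differentiable f x) /\
    (forall v, C_k k' U (fun x => 'd f x v))
  else forall x, U x -> {for x, continuous f}.

Definition smooth_on (V W : normedModType R) (U : set V) (f : V -> W) :=
  forall k, C_k k U f.

(* [S] is a nonempty n-dimensional embedded submanifold of [V]: around each of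
   its points it has a smooth parametrisation by an open subset of R^n that is
   an immersion and a homeomorphism onto an open subset of [S]. *)
Definition has_manifold_dim (V : normedModType R) (S : set V) (n : nat) :=
  S !=set0 /\
  forall p, S p -> exists (U : set 'rV[R]_n) (f : 'rV[R]_n -> V),
    [/\ open U /\ (exists2 x, U x & f x = p),
        smooth_on U f,
        (forall x, U x -> injective ('d f x)),
        (forall x y, U x -> U y -> f x = f y -> x = y) &
        forall U', open U' -> U' `<=` U ->
          exists2 W, open W & f @` U' = S `&` W].

End Dimension.

(* Main.v *)
(* An invariant 3-form is determined by its components on basis vectors. The
   centre -1 of Sp(1) acts by -1 on the quaternionic part H of p, and the units i
   and j leave only the 3-dimensional space spanned by omega_1, omega_2, omega_3
   in the exterior square of H*; this yields the 10-parameter family, linear in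
   (a^3, D^-1). Expanding the wedge products over shuffles, the Gram matrix of the
   bilinear form B in the basis e is block diagonal with blocks
   6 a^3 (D^-1)^T D^-1 and 6 det(D^-1) I, so B is definite iff a det(D^-1) > 0, and
   its sign is that of a. Since B is valued in 7-forms, a change of basis by C
   turns it into det(C) C B C^T, whence the orientation. The G2-structures form an
   open subset of a 10-dimensional linear space. The metrics are all diag(G, t I)
   with G positive definite and t > 0, again an open subset of a linear space, of
   dimension 6 + 1: a Cholesky factor of G provides a preimage. *)
Require Import Defs.
From HB Require Import structures.
From mathcomp Require Import all_boot all_order all_algebra all_fingroup.
From mathcomp Require Import ring lra.
From mathcomp Require Import mathcomp_extra boolp classical_sets functions.
From mathcomp Require Import reals topology normedtype derive exp.

Set Implicit Arguments.
Unset Strict Implicit.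
Unset Printing Implicit Defensive.

Import Order.TTheory GRing.Theory Num.Theory.
Import numFieldNormedType.Exports.

Local Open Scope classical_set_scope.
Local Open Scope ring_scope.

(** Taken literally, [kwedge] gives each entry of the Gram matrix 7! outer terms with 4! inner terms
    in each. Contraction with the first vector is an antiderivation, and iterating that rule leaves
    35 outer and 6 inner shuffles. The resulting recursion computes on integer indices, so every
    entry reduces to a polynomial identity. For the classification, the three group elements -1, i
    and j suffice to cut the forms down to the family; the converse is checked for every unit
    quaternion, where the norm condition enters as a factor equal to 1. Both dimension counts use a
    single global chart that is the restriction of a linear map with a continuous left inverse. Such
    a map has constant differential, so smoothness, injectivity of the differential and the
    homeomorphism condition all come from linear algebra. *)

(** * Wedge products as signed sums over shuffles *)

Lemma sum_lift_perm (R : zmodType) n (F : 'S_n.+1 -> R) :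
  \sum_s F s = \sum_i \sum_(s : 'S_n) F (lift_perm ord0 i s).
Proof.
rewrite pair_big /= (reindex (fun x : 'I_n.+1 * 'S_n => lift_perm ord0 x.1 x.2)) //.
apply/onW_bij/inj_card_bij => [[i s] [j t] /= ist|].
  have ij : i = j by have := congr1 (fun u : 'S_n.+1 => u ord0) ist; rewrite !lift_perm_id.
  subst j; congr pair; apply/permP => k.
  have /(congr1 (fun u : 'S_n.+1 => u (lift ord0 k))) := ist.
  by rewrite !lift_perm_lift => /lift_inj.
by rewrite card_prod !card_Sn card_ord factS.
Qed.

Definition fcons (T : Type) (x : T) (f : nat -> T) (n : nat) : T :=
  if n is m.+1 then f m else x.

(* Sum over the (k, l)-shuffles: the first vector goes either to the left or to
   the right factor, passing the k vectors awaited on the left in the latter case. *)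
Fixpoint shuffle (R : pzRingType) (T : Type) (k : nat) :
    nat -> ((nat -> T) -> R) -> ((nat -> T) -> R) -> (nat -> T) -> R :=
  match k with
  | 0 => fun _ w z f => w f * z f
  | k'.+1 => fix shuffle_r l w z f :=
    let t := shuffle k' l (fun g => w (fcons (f 0) g)) z (fun j => f j.+1) in
    if l is l'.+1 then
      let u := shuffle_r l' w (fun g => z (fcons (f 0) g)) (fun j => f j.+1) in
      if odd k' then t + u else t - u
    else t
  end.

Lemma comp_fcons (S T : Type) (h : S -> T) x f :
  h \o fcons x f = fcons (h x) (h \o f).
Proof. by apply/funext => -[]. Qed.

Lemma shuffleSS (R : pzRingType) (T : Type) k l (w z : (nat -> T) -> R) f :
  shuffle k.+1 l.+1 w z f =
  let t := shuffle k l.+1 (fun g => w (fcons (f 0) g)) z (fun j => f j.+1) in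
  let u := shuffle k.+1 l w (fun g => z (fcons (f 0) g)) (fun j => f j.+1) in
  if odd k then t + u else t - u.
Proof. by []. Qed.

Lemma eq_shuffle (R : pzRingType) (T : Type) k l (w w' z z' : (nat -> T) -> R) f :
  w =1 w' -> z =1 z' -> shuffle k l w z f = shuffle k l w' z' f.
Proof. by move=> /funext -> /funext ->. Qed.

(** Pulling [h] out of the sequence allows a shuffle of basis vectors to be computed on their
    integer indices. *)
Lemma shuffle_comp (R : pzRingType) (S T : Type) (h : S -> T) k l
    (w z : (nat -> T) -> R) (f : nat -> S) :
  shuffle k l w z (h \o f) =
  shuffle k l (fun g => w (h \o g)) (fun g => z (h \o g)) f.
Proof.
elim: k l w z f => [//|k IHk] l; elim: l => [|l IHl] w z f.
  rewrite /= -[fun j => (h \o f) j.+1]/(h \o (fun j => f j.+1)) IHk.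
  by congr (shuffle _ _ _ _ _); apply/funext => g; rewrite comp_fcons.
rewrite !shuffleSS -[fun j => (h \o f) j.+1]/(h \o (fun j => f j.+1)) IHk IHl.
have E (u : (nat -> T) -> R) : (fun g => u (fcons ((h \o f) 0) (h \o g))) =
    (fun g => u (h \o fcons (f 0) g)).
  by apply/funext => g; rewrite comp_fcons.
by rewrite !E.
Qed.

Section Wedge.
Variables (R : realType) (V : lmodType R).
Implicit Types (f : nat -> V) (x y : V).

(* Evaluating forms on sequences indexed by nat avoids casts between the degrees
   [k + l.+1] and [(k + l).+1]. *)
Definition form_at k (w : kform V k) f : R := w (fun i => f i).

Lemma eq_form_at k (w : kform V k) f g :
  (forall i, (i < k)%N -> f i = g i) -> form_at w f = form_at w g.
Proof. by move=> fg; congr w; apply/funext => i; exact: fg. Qed.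

Lemma form_at_kinterior k x (w : kform V k.+1) f :
  form_at (kinterior x w) f = form_at w (fcons x f).
Proof.
congr w; apply/funext => i; case: unliftP => [j|] -> //=.
Qed.

Lemma multilinear_kinterior k x (w : kform V k.+1) :
  multilinear w -> multilinear (kinterior x w).
Proof.
move=> wl v i t y z; rewrite /kinterior.
have E a : (fun i0 => if unlift ord0 i0 is Some j then dfwith v i a j else x) =
   dfwith (fun i0 => if unlift ord0 i0 is Some j then v j else x) (lift ord0 i) a.
  apply/funext => j; case: (unliftP ord0 j) => [j'|] ->; last first.
    by rewrite dfwithout ?unlift_none // eq_sym neq_lift.
  case: (eqVneq i j') => [<-|ij]; first by rewrite !dfwithin.
  by rewrite !dfwithout ?liftK // (inj_eq lift_inj).
by rewrite !E wl.
Qed.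

Lemma alternating_kinterior k x (w : kform V k.+1) :
  alternating w -> alternating (kinterior x w).
Proof.
move=> wa v i j ij vij; apply: (wa _ (lift ord0 i) (lift ord0 j)).
  by rewrite (inj_eq lift_inj).
by rewrite !liftK.
Qed.

Lemma is_kform_kinterior k x (w : kform V k.+1) :
  is_kform w -> is_kform (kinterior x w).
Proof.
by case=> ? ?; split; [exact: multilinear_kinterior|exact: alternating_kinterior].
Qed.

Lemma kform_tperm k (w : kform V k) (v : 'I_k -> V) i j :
  is_kform w -> i != j -> w (fun a => v (tperm i j a)) = - w v.
Proof.
move=> [wl wa] ij.
pose u a b := dfwith (dfwith v i a) j b.
have uC a b : u a b = dfwith (dfwith v j b) i a.
  apply/funext => c; rewrite /u; case: (eqVneq j c) => [<-|jc].
    by rewrite dfwithin dfwithout ?dfwithin.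
  rewrite dfwithout //; case: (eqVneq i c) => [<-|ic]; first by rewrite !dfwithin.
  by rewrite !dfwithout.
have ui a b : u a b i = a by rewrite uC dfwithin.
have uj a b : u a b j = b by rewrite /u dfwithin.
have u0 a : w (u a a) = 0 by apply: (wa _ i j) => //; rewrite ui uj.
have lj a b c : w (u a (b + c)) = w (u a b) + w (u a c).
  by have := wl (dfwith v i a) j 1 b c; rewrite scale1r mul1r.
have li a b c : w (u (a + b) c) = w (u a c) + w (u b c).
  by have := wl (dfwith v j c) i 1 a b; rewrite -!uC scale1r mul1r.
(* Polarisation: [w] vanishes when both slots carry [v i + v j], and so do the two diagonal terms of
   the expansion. *)
have := u0 (v i + v j); rewrite li !lj !u0 add0r addr0.
have -> : u (v i) (v j) = v.
  apply/funext => c; case: (eqVneq i c) => [<-|ic]; first by rewrite ui.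
  case: (eqVneq j c) => [<-|jc]; first by rewrite uj.
  by rewrite /u !dfwithout.
have -> : u (v j) (v i) = (fun a => v (tperm i j a)).
  apply/funext => c; case: tpermP => [->|->|/eqP ci /eqP cj] //.
  by rewrite /u !dfwithout // eq_sym.
by move/eqP; rewrite addrC addr_eq0 => /eqP.
Qed.

Lemma kform_perm k (w : kform V k) (v : 'I_k -> V) (s : 'S_k) :
  is_kform w -> w (fun a => v (s a)) = (-1) ^+ s * w v.
Proof.
move=> wk; case: (prod_tpermP s) => ts -> dts.
elim: ts dts v => [|t ts IH] /= dts v.
  rewrite big_nil odd_perm1 expr0 mul1r; congr w.
  by apply/funext => a; rewrite perm1.
case/andP: dts => dt dts; rewrite big_cons odd_mul_tperm dt.
have -> : (fun a => v ((tperm t.1 t.2 * \prod_(t <- ts) tperm t.1 t.2)%g a)) =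
  (fun a => (fun b => v ((\prod_(t <- ts) tperm t.1 t.2)%g b)) (tperm t.1 t.2 a)).
  by apply/funext => a; rewrite permM.
rewrite (kform_tperm (fun b => v ((\prod_(t <- ts) tperm t.1 t.2)%g b)) wk dt) IH //.
by rewrite signr_addb expr1 mulN1r mulNr.
Qed.

Lemma kinterior_anticomm k x y (w : kform V k.+2) : is_kform w ->
  kinterior x (kinterior y w) = (fun v => - kinterior y (kinterior x w) v).
Proof.
move=> wk; apply/funext => v; rewrite /kinterior.
rewrite -(kform_tperm _ (i := ord0) (j := lift ord0 ord0)) //.
congr w; apply/funext => i; case: (unliftP ord0 i) => [j|] ->; last first.
  by rewrite tpermL liftK unlift_none.
case: (unliftP ord0 j) => [j'|] ->; last by rewrite tpermR unlift_none.
rewrite tpermD // ?liftK //.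
Qed.

Lemma kwedgeNl k l (w : kform V k) (z : kform V l) v :
  kwedge (fun u => - w u) z v = - kwedge w z v.
Proof.
rewrite /kwedge -mulrN -sumrN; congr (_ * _); apply: eq_bigr => s _.
by rewrite mulNr mulrN.
Qed.

Definition wedge_at k l (w : kform V k) (z : kform V l) f := form_at (kwedge w z) f.

(** By antisymmetry of [z] all [l!] permutations contribute the same term, which cancels the
    normalising factor. *)
Lemma wedge_at0 l (w : kform V 0) (z : kform V l) f : is_kform z ->
  wedge_at w z f = form_at w f * form_at z f.
Proof.
move=> zk; rewrite /wedge_at /form_at /kwedge.
rewrite (eq_bigr (fun=> w (fun i => f i) * z (fun i => f i))).
  rewrite sumr_const card_Sn fact0 mul1n -[in X in _ * X]mulr_natl.
  rewrite !mulrA add0n mulVf ?mul1r //.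
  by rewrite pnatr_eq0 -lt0n fact_gt0.
move=> s _.
have -> : (fun i : 'I_0 => f (s (lshift l i))) = (fun i => f i) by apply/funext => -[].
have -> : (fun j => f (s (rshift 0 j))) = (fun a => f (s a)).
  by apply/funext => j; congr (f (s _)); apply: val_inj.
have -> := @kform_perm _ z (fun i => f i) s zk.
by rewrite mulrCA; congr (_ * _); rewrite mulrA -signr_addb addbb expr0 mul1r.
Qed.

(* Laplace expansion along one argument of the left factor, averaged over the k.+1
   arguments. *)
Lemma wedge_at_laplace k l (w : kform V k.+1) (z : kform V l) f :
  k.+1%:R * wedge_at w z f = \sum_(0 <= i < (k + l).+1)
    (-1) ^+ i * wedge_at (kinterior (f i) w) z (fun j => f (bump i j)).
Proof.
rewrite big_mkord /wedge_at /form_at /kwedge (sum_lift_perm (n := (k + l)%N)).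
rewrite factS -mulnA natrM invfM mulrA mulrA mulfV ?pnatr_eq0 // mul1r big_distrr /=.
apply: eq_bigr => i _; rewrite mulrCA; congr (_ * _).
rewrite big_distrr /=; apply: eq_bigr => s _.
rewrite odd_lift_perm /= signr_addb signr_odd -mulrA; congr (_ * (_ * (_ * _))).
  congr w; apply/funext => a; case: (unliftP ord0 a) => [b|] ->.
    have -> : lshift l (lift ord0 b) = lift ord0 (lshift l b) :> 'I_(k + l).+1.
      exact: val_inj.
    by rewrite lift_perm_lift.
  have -> : lshift l (ord0 : 'I_k.+1) = ord0 :> 'I_(k + l).+1 by apply: val_inj.
  by rewrite lift_perm_id.
congr z; apply/funext => b.
have -> : rshift k.+1 b = lift ord0 (rshift k b) :> 'I_(k + l).+1 by apply: val_inj.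
by rewrite lift_perm_lift.
Qed.

Lemma fcons_bump f i : (fun j => f (bump i.+1 j)) = fcons (f 0) (fun j => f (bump i j).+1).
Proof. by apply/funext => -[|j] //=; rewrite bumpS. Qed.

Lemma comp_bump0 f : (fun j => f (bump 0 j)) = (fun j => f j.+1).
Proof. by apply/funext => j. Qed.

(** The antiderivation rule for contraction with the first vector. The induction on the degree of
    [w] compares Laplace expansions after multiplying by that degree. *)
Lemma wedge_atS k l (w : kform V k.+1) (z : kform V l.+1) f :
  is_kform w -> is_kform z ->
  wedge_at w z f = wedge_at (kinterior (f 0) w) z (fun j => f j.+1) +
    (-1) ^+ k.+1 * wedge_at w (kinterior (f 0) z) (fun j => f j.+1).
Proof.
elim: k w f => [|k IH] w f wk zk.
  have := wedge_at_laplace w z f; rewrite mul1r => ->.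
  rewrite big_nat_recl //= expr0 mul1r comp_bump0; congr (_ + _).
  have := wedge_at_laplace w (kinterior (f 0) z) (fun j => f j.+1); rewrite mul1r => ->.
  rewrite add0n big_distrr; apply: eq_bigr => i _ /=.
  rewrite exprS -mulrA; congr (_ * (_ * _)).
  rewrite !wedge_at0 //; last exact: is_kform_kinterior.
  rewrite fcons_bump !form_at_kinterior; congr (_ * _).
  by apply: eq_form_at => -[].
have k0 : k.+2%:R != 0 :> R by rewrite pnatr_eq0.
apply: (mulfI k0); rewrite wedge_at_laplace big_nat_recl //= expr0 mul1r comp_bump0.
(* In these summands [f 0] still comes first, so the induction hypothesis contracts it, and
   exchanging the two contractions of [w] absorbs one sign. The two sums are again Laplace
   expansions, with weights [k.+1] and [k.+2]; the separated term raises the first weight to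
   [k.+2]. *)
rewrite (eq_bigr (fun i => (-1) ^+ i *
     wedge_at (kinterior (f i.+1) (kinterior (f 0) w)) z (fun j => f (bump i j).+1)
   + (-1) ^+ k.+2 * ((-1) ^+ i *
      wedge_at (kinterior (f i.+1) w) (kinterior (f 0) z) (fun j => f (bump i j).+1)))); last first.
  move=> i _; rewrite fcons_bump IH //=; last exact: is_kform_kinterior.
  rewrite kinterior_anticomm // /wedge_at /form_at kwedgeNl !exprS; ring.
rewrite big_split /= -big_distrr /=.
have := wedge_at_laplace (kinterior (f 0) w) z (fun j => f j.+1); rewrite -addSn => <-.
have := wedge_at_laplace w (kinterior (f 0) z) (fun j => f j.+1); rewrite -addnS => <-.
rewrite -[k.+2%:R]natr1; ring.
Qed.

(** The boundary case of the antiderivation rule: a right factor of degree 0 has no contraction. *)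
Lemma wedge_atS0 k (w : kform V k.+1) (z : kform V 0) f : is_kform w ->
  wedge_at w z f = wedge_at (kinterior (f 0) w) z (fun j => f j.+1).
Proof.
elim: k w f => [|k IH] w f wk.
  have := wedge_at_laplace w z f; rewrite mul1r => ->.
  by rewrite big_nat1 expr0 mul1r.
have k0 : k.+2%:R != 0 :> R by rewrite pnatr_eq0.
apply: (mulfI k0); rewrite wedge_at_laplace big_nat_recl //= expr0 mul1r comp_bump0.
rewrite (eq_bigr (fun i => (-1) ^+ i *
     wedge_at (kinterior (f i.+1) (kinterior (f 0) w)) z (fun j => f (bump i j).+1))); last first.
  move=> i _; rewrite fcons_bump IH //=; last exact: is_kform_kinterior.
  rewrite kinterior_anticomm // /wedge_at /form_at kwedgeNl !exprS; ring.
rewrite addSn -wedge_at_laplace -[k.+2%:R]natr1; ring.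
Qed.

(** [shuffle] is the antiderivation rule unrolled, so a sum over (k + l)! permutations shrinks to
    binomially many terms. *)
Lemma wedge_at_shuffle k l (w : kform V k) (z : kform V l) f : is_kform w -> is_kform z ->
  wedge_at w z f = shuffle k l (form_at w) (form_at z) f.
Proof.
move=> wk; elim: k l w wk z f => [|k IHk] l w wk z f zk; first by rewrite wedge_at0.
have E x m (t : kform V m.+1) : (fun g => form_at t (fcons x g)) = form_at (kinterior x t).
  by apply/funext => g; rewrite form_at_kinterior.
elim: l z f zk => [|l IHl] z f zk.
  by rewrite wedge_atS0 //= IHk ?E //; exact: is_kform_kinterior.
rewrite wedge_atS // IHk //; last exact: is_kform_kinterior.
rewrite IHl; last exact: is_kform_kinterior.
by rewrite -[LHS]/(_ + _) /= !E exprS -signr_odd; case: (odd k); rewrite ?expr0 ?expr1; ring.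
Qed.

End Wedge.

(** * Closure properties of alternating forms and their values on spanning families *)

Section FormClosure.
Variables (R : realType) (V : lmodType R).

Lemma multilinear_lincomb k (w z : kform V k) (t : R) :
  multilinear w -> multilinear z -> multilinear (fun v => t * w v + z v).
Proof. by move=> wl zl v i s x y; rewrite wl zl; ring. Qed.

Lemma is_kformD k (w z : kform V k) : is_kform w -> is_kform z ->
  is_kform (w + z : kform V k).
Proof.
move=> [wl wa] [zl za]; split=> [v i s x y|v i j ij vij].
  by rewrite !fctE wl zl; ring.
by rewrite !fctE (wa _ i j) // (za _ i j) // addr0.
Qed.

Lemma is_kformZ k t (w : kform V k) : is_kform w -> is_kform (t *: w : kform V k).
Proof.
move=> [wl wa]; split=> [v i s x y|v i j ij vij].
  by rewrite !fctE wl /GRing.scale /=; ring.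
by rewrite !fctE (wa _ i j) // scaler0.
Qed.

Lemma is_kformN k (w : kform V k) : is_kform w -> is_kform (- w : kform V k).
Proof.
move=> [wl wa]; split=> [v i s x y|v i j ij vij].
  by rewrite !fctE wl; ring.
by rewrite !fctE (wa _ i j) // oppr0.
Qed.

Lemma is_kform0 k : is_kform (0 : kform V k).
Proof.
have -> : (0 : kform V k) = fun=> 0 by [].
by split=> [v i s x y|v i j ij vij]; rewrite ?mulr0 ?addr0.
Qed.

Lemma is_kform_sum k (I : finType) (w : I -> kform V k) :
  (forall i, is_kform (w i)) -> is_kform (\sum_i w i : kform V k).
Proof.
by move=> wk; elim/big_rec: _ => [|i z _ zk]; [exact: is_kform0|exact: is_kformD].
Qed.

(** Composing with the transposition of [i] and [j] leaves both factors unchanged, as [v i = v j],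
    but flips the sign; the sum is thus its own opposite. *)
Lemma alternating_kwedge k l (w : kform V k) (z : kform V l) :
  alternating (kwedge w z).
Proof.
move=> v i j ij vij; rewrite /kwedge.
set S := \sum_s _; suff SN : S = - S.
  by move/eqP: SN; rewrite -addr_eq0 -mulr2n mulrn_eq0 /= => /eqP ->; rewrite mulr0.
rewrite {1}/S (reindex_inj (mulIg (tperm i j))) /= /S -sumrN.
apply: eq_bigr => s _.
have vt a : v ((s * tperm i j)%g a) = v (s a).
  by rewrite permM; case: tpermP => // ->.
rewrite odd_permM odd_tperm ij signr_addb expr1 mulrN1 mulNr.
by congr (- (_ * (_ * _))); [congr w|congr z]; apply/funext => a; rewrite vt.
Qed.

Lemma multilinear_kwedge k l (w : kform V k) (z : kform V l) :
  multilinear w -> multilinear z -> multilinear (kwedge w z).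
Proof.
move=> wl zl v i t x y; rewrite /kwedge mulrCA -mulrDr; congr (_ * _).
rewrite mulr_sumr -big_split /=; apply: eq_bigr => s _.
(* Under each permutation the varied argument occupies one slot [m], hence lies in exactly one of
   the two factors, which is linear in it. *)
have [m sm] : exists m, s m = i by exists (s^-1%g i); rewrite permKV.
case: (split_ordP m) => a ma.
  have E u : (fun b => dfwith v i u (s (lshift l b))) = dfwith (fun b => v (s (lshift l b))) a u.
    apply/funext => b; case: (eqVneq a b) => [<-|ab].
      by rewrite dfwithin -ma sm dfwithin.
    by rewrite !dfwithout // -sm ma (inj_eq perm_inj) (inj_eq (@lshift_inj _ _)).
  have F u : (fun b => dfwith v i u (s (rshift k b))) = (fun b => v (s (rshift k b))).
    by apply/funext => b; rewrite dfwithout // -sm ma (inj_eq perm_inj) eq_lrshift.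
  rewrite !E !F wl.
by move: ((-1) ^+ s) (w _) (w _) (z _) => a1 a2 a3 a4; ring.
have E u : (fun b => dfwith v i u (s (rshift k b))) = dfwith (fun b => v (s (rshift k b))) a u.
  apply/funext => b; case: (eqVneq a b) => [<-|ab].
    by rewrite dfwithin -ma sm dfwithin.
  by rewrite !dfwithout // -sm ma (inj_eq perm_inj) (inj_eq (@rshift_inj _ _)).
have F u : (fun b => dfwith v i u (s (lshift l b))) = (fun b => v (s (lshift l b))).
  by apply/funext => b; rewrite dfwithout // -sm ma (inj_eq perm_inj) eq_rlshift.
rewrite !E !F zl.
by move: ((-1) ^+ s) (z _) (z _) (w _) => a1 a2 a3 a4; ring.
Qed.

Lemma is_kform_kwedge k l (w : kform V k) (z : kform V l) :
  is_kform w -> is_kform z -> is_kform (kwedge w z).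
Proof.
by move=> [wl _] [zl _]; split; [exact: multilinear_kwedge|exact: alternating_kwedge].
Qed.

Lemma kwedge_linearl k l (w w' : kform V k) (z : kform V l) t v :
  kwedge (fun u => t * w u + w' u) z v = t * kwedge w z v + kwedge w' z v.
Proof.
rewrite /kwedge mulrCA -mulrDr; congr (_ * _).
rewrite mulr_sumr -big_split /=; apply: eq_bigr => s _.
by move: ((-1) ^+ s) (w _) (w' _) (z _) => a1 a2 a3 a4; ring.
Qed.

Lemma kwedge_linearr k l (w : kform V k) (z z' : kform V l) t v :
  kwedge w (fun u => t * z u + z' u) v = t * kwedge w z v + kwedge w z' v.
Proof.
rewrite /kwedge mulrCA -mulrDr; congr (_ * _).
rewrite mulr_sumr -big_split /=; apply: eq_bigr => s _.
by move: ((-1) ^+ s) (w _) (z _) (z' _) => a1 a2 a3 a4; ring.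
Qed.

Lemma kinterior_linear k (w : kform V k.+1) t x y : multilinear w ->
  kinterior (t *: x + y) w = fun v => t * kinterior x w v + kinterior y w v.
Proof.
move=> wl; apply/funext => v.
pose g : 'I_k.+1 -> V := fun i => if unlift ord0 i is Some j then v j else 0.
have E u : kinterior u w v = w (dfwith g ord0 u).
  congr w; apply/funext => i; case: unliftP => [j|] ->; last by rewrite dfwithin.
  by rewrite dfwithout ?neq_lift // /g liftK.
by rewrite !E wl.
Qed.

Lemma multilinear_sum k (w : kform V k) (v : 'I_k -> V) i (I : finType)
    (c : I -> R) (x : I -> V) : multilinear w ->
  w (dfwith v i (\sum_j c j *: x j)) = \sum_j c j * w (dfwith v i (x j)).
Proof.
move=> wl.
have w0 : w (dfwith v i 0) = 0.
  by have := wl v i (-1) 0 0; rewrite scaler0 addr0 mulN1r addNr.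
(* Both sides become sums over the same list of pairs, so that induction on the list applies. *)
rewrite -!(big_map (fun j => (c j, x j)) xpredT (fun p => p.1 *: p.2)).
rewrite -!(big_map (fun j => (c j, x j)) xpredT (fun p => p.1 * w (dfwith v i p.2))).
by elim: map => [|a s IH]; rewrite ?big_nil // !big_cons wl IH.
Qed.

Lemma multilinear_span0 k (w : kform V k) n (b : 'I_n -> V) (c : 'I_n -> V -> R) :
  (forall x, x = \sum_j c j x *: b j) -> multilinear w ->
  (forall s : 'I_k -> 'I_n, w (fun i => b (s i)) = 0) -> forall v, w v = 0.
Proof.
move=> bP wl w0.
(* [m] bounds the number of leading arguments that may be arbitrary; all later ones are already
   basis vectors. *)
suff H m (v : 'I_k -> V) : (forall i : 'I_k, (m <= i)%N -> exists j, v i = b j) -> w v = 0.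
  by move=> v; apply: (H k) => i; rewrite leqNgt ltn_ord.
elim: m v => [|m IH] v vP.
  have vP' i : exists j, v i = b j by exact: vP.
  have -> : v = (fun i => b (projT1 (cid (vP' i)))).
    by apply/funext => i; case: cid.
  exact: w0.
have [mk|km] := ltnP m k; last first.
  by apply: IH => i; rewrite leqNgt (leq_trans (ltn_ord i)).
pose i := Ordinal mk.
have -> : v = dfwith v i (\sum_j c j (v i) *: b j).
  rewrite -bP; apply/funext => j; case: (eqVneq i j) => [<-|ij].
    by rewrite dfwithin.
  by rewrite dfwithout.
rewrite multilinear_sum // big1 // => j _; rewrite IH ?mulr0 // => a ma.
case: (eqVneq i a) => [<-|ia]; first by exists j; rewrite dfwithin.
rewrite dfwithout //; apply: vP; rewrite ltn_neqAle ma andbT.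
by apply: contra ia => /eqP ma'; apply/eqP/val_inj.
Qed.

End FormClosure.

(** * Forms on p and their values on the basis *)

Section PForms.
Variable R : realType.
Let p := pspace R.

Lemma ecoord_linear i (t : R) (x y : p) : ecoord i (t *: x + y) = t * ecoord i x + ecoord i y.
Proof.
rewrite !ecoordE.
by case: i => [[|[|[|[|[|[|[|//]]]]]]] hi]; rewrite !(tnth_nth 0) /= !mxE ?quatE /=; ring.
Qed.

Lemma multilinear_ext k (w z : kform p k) : multilinear w -> multilinear z ->
  (forall s : 'I_k -> 'I_7, w (fun i => e R (s i)) = z (fun i => e R (s i))) -> w = z.
Proof.
move=> wl zl wz; apply/funext => v; apply/eqP; rewrite -subr_eq0; apply/eqP.
have := multilinear_span0 (@ecoord_sum R) (multilinear_lincomb (-1) zl wl).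
move=> /(_ _ v) <-; first by ring.
by move=> s; rewrite wz; ring.
Qed.

Lemma det_coord_mx_kform : is_kform ((fun v : 'I_7 -> p => \det (coord_mx v)) : kform p 7).
Proof.
split=> [v i t x y|v i j ij vij].
  rewrite -[X in _ = _ + X]mul1r.
  apply: (determinant_multilinear (i0 := i)).
  - by apply/rowP => b; rewrite !mxE !dfwithin ecoord_linear; ring.
  - by apply/matrixP => a b; rewrite !mxE !dfwithout // neq_lift.
  - by apply/matrixP => a b; rewrite !mxE !dfwithout // neq_lift.
by apply: (determinant_alternate ij) => b; rewrite !mxE vij.
Qed.

(** The determinant of the coordinates spans the 7-forms: on basis vectors with a repeated index
    both sides vanish, and on a permutation of the basis both give its sign. *)
Lemma top_form (w : kform p 7) (b : 'I_7 -> p) : is_kform w ->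
  w b = \det (coord_mx b) * w (@e R).
Proof.
move=> wk; have [wl wa] := wk; have [dl da] := det_coord_mx_kform.
have Dl : multilinear ((fun v => w (@e R) * \det (coord_mx v) + 0) : kform p 7).
  by apply: multilinear_lincomb => // v i t x y; rewrite mulr0 addr0.
rewrite [RHS]mulrC -[RHS]addr0.
suff wE : w = (fun v => w (@e R) * \det (coord_mx v) + 0) by rewrite {1}wE.
apply: multilinear_ext => // s.
have [/injectiveP sI|/injectivePn [i [j ij sij]]] := boolP (injectiveb s); last first.
  by rewrite (wa _ i j) ?sij // (da _ i j) ?sij // mulr0 addr0.
have -> : (fun i => e R (s i)) = (fun i => e R (perm sI i)).
  by apply/funext => i; rewrite permE.
rewrite kform_perm //.
have -> : coord_mx (fun i => e R (perm sI i)) = perm_mx (perm sI).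
  by apply/matrixP => a c; rewrite !mxE ecoord_e eq_sym.
by rewrite det_perm addr0 mulrC.
Qed.

End PForms.

(** * Components of the ten-parameter family *)

Section G2FormCoefficients.
Variable R : realType.
Let p := pspace R.

Lemma is_kform_de n : is_kform (@de R n).
Proof.
split=> [v i t x y|v i j]; last by rewrite !ord1 eqxx.
by rewrite /de (ord1 i) !dfwithin ecoord_linear.
Qed.

Definition pcoord (n : nat) (x : p) : R := ecoord (inord n.-1) x.

Lemma form_at_de n f : form_at (@de R n) f = pcoord n (f 0%N).
Proof. by []. Qed.

Definition coord_minor (x y : nat) (u v : p) :=
  pcoord x u * pcoord y v - pcoord y u * pcoord x v.

Lemma kwedge_de2 x y f :
  form_at (kwedge (@de R x) (@de R y)) f = coord_minor x y (f 0%N) (f 1%N).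
Proof.
rewrite -/(wedge_at _ _ _) wedge_at_shuffle; do ?exact: is_kform_de.
by rewrite /= !form_at_de /= /coord_minor [pcoord y _ * _]mulrC.
Qed.

Lemma is_kform_kwedge_de x y : is_kform (kwedge (@de R x) (@de R y)).
Proof. by apply: is_kform_kwedge; exact: is_kform_de. Qed.

Lemma kwedge_de3 f :
  form_at (kwedge (kwedge (@de R 1) (@de R 2)) (de 3) : kform p 3) f =
  coord_minor 1 2 (f 0%N) (f 1%N) * pcoord 3 (f 2%N)
  - coord_minor 1 2 (f 0%N) (f 2%N) * pcoord 3 (f 1%N)
  + coord_minor 1 2 (f 1%N) (f 2%N) * pcoord 3 (f 0%N).
Proof.
rewrite -[LHS]/(wedge_at (kwedge (@de R 1) (@de R 2)) (de 3) f) wedge_at_shuffle;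
  [|exact: is_kform_kwedge_de|exact: is_kform_de].
by rewrite /= !kwedge_de2 !form_at_de /=; ring.
Qed.

Lemma kwedge12E (a : kform p 1) (w : kform p 2) f : is_kform a -> is_kform w ->
  form_at (kwedge a w : kform p 3) f =
  form_at a (fun=> f 0%N) * form_at w (fcons (f 1%N) (fun=> f 2%N))
  - (form_at a (fun=> f 1%N) * form_at w (fcons (f 0%N) (fun=> f 2%N))
     - form_at a (fun=> f 2%N) * form_at w (fcons (f 0%N) (fun=> f 1%N))).
Proof.
move=> ak wk; rewrite -[LHS]/(wedge_at a w f) wedge_at_shuffle //=.
by congr (_ * _ - (_ * _ - _ * _)); apply: eq_form_at => -[|[]].
Qed.

Definition omega_val (r : nat) (u v : p) : R :=
  match r with
  | 0 => coord_minor 4 7 u v + coord_minor 5 6 u v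
  | 1 => coord_minor 4 6 u v - coord_minor 5 7 u v
  | _ => coord_minor 4 5 u v + coord_minor 6 7 u v
  end.

Lemma is_kform_omega :
  [/\ is_kform (@omega1 R), is_kform (@omega2 R) & is_kform (@omega3 R)].
Proof.
have dd := is_kform_kwedge_de.
by split; apply: is_kformD => //; exact: is_kformN.
Qed.

Lemma form_at_omega f :
  [/\ form_at (@omega1 R) f = omega_val 0 (f 0%N) (f 1%N),
       form_at (@omega2 R) f = omega_val 1 (f 0%N) (f 1%N) &
       form_at (@omega3 R) f = omega_val 2 (f 0%N) (f 1%N)].
Proof. by split; rewrite /omega_val -!kwedge_de2. Qed.

Definition row_form (M : 'M[R]_3) (r : 'I_3) (x : p) : R :=
  \sum_(i < 3) M r i * pcoord i.+1 x.

Lemma is_kform_row (M : 'M[R]_3) r : is_kform (\sum_(i < 3) M r i *: @de R i.+1 : kform p 1).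
Proof. by apply: is_kform_sum => i; apply/is_kformZ/is_kform_de. Qed.

Lemma form_at_row (M : 'M[R]_3) r f :
  form_at (\sum_(i < 3) M r i *: @de R i.+1 : kform p 1) f = row_form M r (f 0%N).
Proof. by rewrite /form_at fct_sumE. Qed.

Lemma is_kform_G2_form a M : is_kform (@G2_form R a M).
Proof.
have [o1 o2 o3] := is_kform_omega.
have rk M' r := @is_kform_row M' r.
rewrite /G2_form; do 3![apply: is_kformD; last exact: (@is_kform_kwedge _ _ 1 2)].
apply/is_kformZ/(@is_kform_kwedge _ _ 2 1); last exact: is_kform_de.
exact: is_kform_kwedge_de.
Qed.

Lemma form_at_G2_form a M f :
  let u := f 0%N in let v := f 1%N in let w := f 2%N in
  form_at (G2_form a M) f =
  a ^+ 3 * (coord_minor 1 2 u v * pcoord 3 w - coord_minor 1 2 u w * pcoord 3 v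
            + coord_minor 1 2 v w * pcoord 3 u)
  + \sum_(r < 3) (row_form M r u * omega_val r v w - (row_form M r v * omega_val r u w
                   - row_form M r w * omega_val r u v)).
Proof.
have [o1 o2 o3] := is_kform_omega.
move=> u v w.
pose rf r : kform p 1 := \sum_(i < 3) M r i *: @de R i.+1.
have K r (o : kform p 2) q : is_kform o ->
    (forall g, form_at o g = omega_val q (g 0%N) (g 1%N)) ->
    form_at (kwedge (rf r) o : kform p 3) f =
    row_form M r u * omega_val q v w
    - (row_form M r v * omega_val q u w - row_form M r w * omega_val q u v).
  move=> ok oE; rewrite kwedge12E //; last exact: is_kform_row.
  by rewrite !oE !form_at_row.
transitivity (a ^+ 3 * form_at (kwedge (kwedge (@de R 1) (@de R 2)) (@de R 3) : kform p 3) f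
    + form_at (kwedge (rf 0) (@omega1 R) : kform p 3) f
    + form_at (kwedge (rf 1) (@omega2 R) : kform p 3) f
    + form_at (kwedge (rf 2) (@omega3 R) : kform p 3) f); first by [].
rewrite -!addrA !big_ord_recl big_ord0 addr0.
congr (_ * _ + (_ + (_ + _))); first by rewrite kwedge_de3 addrA.
- by apply: (K _ _ 0%N) => // g; case: (form_at_omega g).
- have -> : lift ord0 ord0 = 1 :> 'I_3 by exact: val_inj.
  by apply: (K _ _ 1%N) => // g; case: (form_at_omega g).
- have -> : lift ord0 (lift ord0 ord0) = 2 :> 'I_3 by exact: val_inj.
  by apply: (K _ _ 2%N) => // g; case: (form_at_omega g).
Qed.

(* The components of an alternating form whose components with increasing
   indices are given by [T]. *)
Definition alt3 (T : nat -> nat -> nat -> R) (i j k : nat) : R :=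
  if (i < j)%N then
    if (j < k)%N then T i j k else if (i < k)%N then - T i k j else T k i j
  else
    if (i < k)%N then - T j i k else if (j < k)%N then T j k i else - T k j i.

(* The components of [G2_form a M], with [c = a ^+ 3], in the 0-based numbering
   and for increasing indices. *)
Definition G2_coef (c : R) (m : nat -> nat -> R) (i j k : nat) : R :=
  match i, j, k with
  | 0, 1, 2 => c
  | (0 | 1 | 2), 3, 6 | (0 | 1 | 2), 4, 5 => m 0%N i
  | (0 | 1 | 2), 3, 5 => m 1%N i
  | (0 | 1 | 2), 4, 6 => - m 1%N i
  | (0 | 1 | 2), 3, 4 | (0 | 1 | 2), 5, 6 => m 2%N i
  | _, _, _ => 0
  end.

Definition mxentry n (M : 'M[R]_n.+1) (i j : nat) : R := M (inord i) (inord j).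

(* Extending the basis by zero makes the component formulas unconditional. *)
Definition e0 (i : nat) : p := if (i < 7)%N then e R (inord i) else 0.

Lemma ecoord0 i : ecoord i (0 : p) = 0.
Proof. by have := ecoord_linear i (-1) 0 (0 : p); rewrite scaler0 addr0 mulN1r addNr. Qed.

Lemma pcoord_e0 n i : (n < 7)%N -> pcoord n.+1 (e0 i) = (n == i)%:R.
Proof.
move=> n7; rewrite /pcoord /e0; case: ltnP => i7; last first.
  by rewrite ecoord0 ltn_eqF // (leq_trans n7).
by rewrite ecoord_e -val_eqE /= !inordK.
Qed.

Lemma row_form_e0 (M : 'M[R]_3) r i : (r < 3)%N ->
  row_form M (inord r) (e0 i) = if (i < 3)%N then mxentry M r i else 0.
Proof.
move=> r3; rewrite /row_form; case: ifPn => [i3|].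
  rewrite (bigD1 (inord i)) //= big1 ?addr0 => [|j ji].
    by rewrite (inordK i3) pcoord_e0 ?(leq_trans i3) // eqxx mulr1.
  rewrite pcoord_e0 ?(leq_trans (ltn_ord j)) //; case: eqP => [E|_].
    by rewrite -E inord_val eqxx in ji.
  by rewrite mulr0.
rewrite -leqNgt => i3; rewrite big1 // => j _.
rewrite pcoord_e0 ?(leq_trans (ltn_ord j)) //.
by rewrite (ltn_eqF (leq_trans (ltn_ord j) i3)) mulr0.
Qed.

Lemma form_at_G2_form_e0 a M (s : nat -> nat) :
  form_at (G2_form a M) (e0 \o s) =
  alt3 (G2_coef (a ^+ 3) (mxentry M)) (s 0%N) (s 1%N) (s 2%N).
Proof.
rewrite form_at_G2_form /= !big_ord_recl big_ord0 addr0.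
move: (s 0%N) (s 1%N) (s 2%N) => i j k.
have -> : lift ord0 (lift ord0 ord0) = inord 2 :> 'I_3 by apply: val_inj; rewrite /= inordK.
have -> : lift ord0 ord0 = inord 1 :> 'I_3 by apply: val_inj; rewrite /= inordK.
have -> : ord0 = inord 0 :> 'I_3 by apply: val_inj; rewrite /= inordK.
rewrite !row_form_e0 // !inordK // /omega_val /coord_minor !pcoord_e0 //.
move: (a ^+ 3) (mxentry M) => c m.
have S := (mul0r, mulr0, mul1r, mulr1, subr0, sub0r, addr0, add0r, oppr0).
(* Eight cases per index: the seven basis vectors, and all indices from 7 on, where [e0] is zero. *)
case: i => [|[|[|[|[|[|[|i]]]]]]]; rewrite /= ?S;
  case: j => [|[|[|[|[|[|[|j]]]]]]]; rewrite /= ?S;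
  case: k => [|[|[|[|[|[|[|k]]]]]]]; rewrite /= /alt3 /= ?S; do ?[case: ifP => _]; ring.

Qed.


End G2FormCoefficients.

(** * The Gram matrix of the bilinear form *)

Section G2Bilin.
Variable R : realType.
Let p := pspace R.

Lemma G2_bilin_mx_e a M (i j : 'I_7) :
  G2_bilin_mx (G2_form a M) (@e R) i j =
  let T := alt3 (G2_coef (a ^+ 3) (mxentry M)) in
  shuffle 4 3
    (fun g => shuffle 2 2 (fun u => T i (u 0%N) (u 1%N)) (fun u => T j (u 0%N) (u 1%N)) g)
    (fun g => T (g 0%N) (g 1%N) (g 2%N)) id.
Proof.
(* Writing the basis as [e0] after the identity allows [shuffle_comp] to strip [e0] and leave
   indices only. *)
have eE : (@e R) = (fun i : 'I_7 => e0 R i).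
  by apply/funext => k; rewrite /e0 ltn_ord inord_val.
have pk := is_kform_G2_form a M.
have kk (x : p) : is_kform (kinterior x (G2_form a M)) by exact: is_kform_kinterior.
rewrite mxE {3}eE -[LHS]/(wedge_at (kwedge (kinterior (e R i) (G2_form a M))
  (kinterior (e R j) (G2_form a M))) (G2_form a M) (e0 R \o id)).
rewrite wedge_at_shuffle //; last exact: is_kform_kwedge.
rewrite shuffle_comp; apply: eq_shuffle => g; last exact: form_at_G2_form_e0.
rewrite -[LHS]/(wedge_at (kinterior (e R i) (G2_form a M))
  (kinterior (e R j) (G2_form a M)) (e0 R \o g)) wedge_at_shuffle // shuffle_comp.
have K (l : 'I_7) u : form_at (kinterior (e R l) (G2_form a M)) (e0 R \o u) =
    alt3 (G2_coef (a ^+ 3) (mxentry M)) l (u 0%N) (u 1%N).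
  by rewrite form_at_kinterior eE -comp_fcons form_at_G2_form_e0.
by apply: eq_shuffle => u; exact: K.
Qed.

Lemma det3E (M : 'M[R]_3) : let m := mxentry M in \det M =
  m 0%N 0%N * (m 1%N 1%N * m 2%N 2%N - m 1%N 2%N * m 2%N 1%N)
  - m 0%N 1%N * (m 1%N 0%N * m 2%N 2%N - m 1%N 2%N * m 2%N 0%N)
  + m 0%N 2%N * (m 1%N 0%N * m 2%N 1%N - m 1%N 1%N * m 2%N 0%N).
Proof.
have ME i j : M i j = mxentry M i j by rewrite /mxentry !inord_val.
rewrite /= (expand_det_row _ ord0) !big_ord_recl big_ord0 /cofactor.
rewrite !(expand_det_row _ ord0) !big_ord_recl !big_ord0 /cofactor !det_mx11 !mxE !ME /=.
by ring.
Qed.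

Lemma G2_bilin_e a M : G2_bilin_mx (G2_form a M) (@e R) =
  block_mx ((6 * a ^+ 3) *: (M^T *m M)) 0 0 ((6 * \det M)%:M : 'M_4) :> 'M_(3 + 4).
Proof.
have ME i j : M i j = mxentry M i j by rewrite /mxentry !inord_val.
(* Splitting the indices along 3 + 4 selects the block; unfolding the shuffles then leaves one
   [ring] identity per entry. *)
apply/matrixP => i j; rewrite G2_bilin_mx_e.
case: (split_ordP i) => x ->{i}; case: (split_ordP j) => y ->{j};
  rewrite ?block_mxEul ?block_mxEur ?block_mxEdl ?block_mxEdr !mxE ?det3E
    ?(big_ord_recl, big_ord0) ?mxE ?ME;
  case: x => [[|[|[|[|//]]]] hx] //; case: y => [[|[|[|[|//]]]] hy] //;
  rewrite /= /alt3 /=; ring.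
Qed.
End G2Bilin.

(** * Positive definite matrices *)

Section PosDef.
Variable R : realType.

Lemma quad_formZ n t (A : 'M[R]_n) (x : 'rV[R]_n) :
  (x *m (t *: A) *m x^T) 0 0 = t * (x *m A *m x^T) 0 0.
Proof. by rewrite -scalemxAr -scalemxAl mxE. Qed.

(** The dimension is positive because on the zero space every form is vacuously positive definite,
    whatever the sign of [t]. *)
Lemma posdef_mxZ n t (A : 'M[R]_n.+1) : posdef_mx A -> posdef_mx (t *: A) <-> 0 < t.
Proof.
move=> Ap; split=> [/(_ (const_mx 1))|t0 x x0]; last first.
  by rewrite quad_formZ mulr_gt0 // Ap.
have c0 : const_mx 1 != 0 :> 'rV[R]_n.+1.
  by apply/eqP => /rowP/(_ ord0); rewrite !mxE => /eqP; rewrite oner_eq0.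
by move=> /(_ c0); rewrite quad_formZ pmulr_lgt0 // Ap.
Qed.

Lemma posdef_mx_congr n (A C : 'M[R]_n) : C \in unitmx ->
  posdef_mx A -> posdef_mx (C *m A *m C^T).
Proof.
move=> Cu Ap x x0; rewrite !mulmxA -[_ *m x^T]mulmxA -trmx_mul; apply: Ap.
by apply: contra x0 => /eqP xC; rewrite -[x](mulmxK Cu) xC mul0mx.
Qed.

Lemma posdef_mx1 n : posdef_mx (1%:M : 'M[R]_n).
Proof.
move=> x x0; rewrite mulmx1 mxE.
have E i : x 0 i * x^T i 0 = x 0 i ^+ 2 by rewrite mxE expr2.
rewrite (eq_bigr _ (fun i _ => E i)) lt0r sumr_ge0 ?andbT => [|i _]; last exact: sqr_ge0.
apply: contra x0 => /eqP s0; apply/eqP/rowP => i; rewrite mxE; apply/eqP.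
by rewrite -sqrf_eq0; have /psumr_eq0P -> // := s0 => j _; exact: sqr_ge0.
Qed.

Lemma posdef_mx_gram n (M : 'M[R]_n) : M \in unitmx -> posdef_mx (M^T *m M).
Proof.
move=> Mu; have := posdef_mx_congr (C := M^T) _ (@posdef_mx1 n).
by rewrite unitmx_tr trmxK mulmx1 => /(_ Mu).
Qed.

Lemma posdef_block_mx m n (A : 'M[R]_m) (B : 'M[R]_n) :
  posdef_mx A -> posdef_mx B -> posdef_mx (block_mx A 0 0 B).
Proof.
move=> Ap Bp x; rewrite -[x]hsubmxK => x0.
rewrite mul_row_block !mulmx0 addr0 add0r tr_row_mx mul_row_col mxE.
have ge0 k (C : 'M[R]_k) (z : 'rV_k) : posdef_mx C -> 0 <= (z *m C *m z^T) 0 0.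
  move=> Cp; have [->|/Cp/ltW//] := eqVneq z 0.
  by rewrite !mul0mx mxE.
have [l0|l0] := eqVneq (lsubmx x) 0; last by rewrite ltr_pwDl ?Ap ?ge0.
rewrite ltr_wpDl ?ge0 // Bp //; apply: contra x0 => /eqP ->.
by rewrite l0 row_mx0.
Qed.

Lemma posdef_mx_diag n (A : 'M[R]_n) i : posdef_mx A -> 0 < A i i.
Proof.
move=> /(_ (delta_mx 0 i)); rewrite -rowE trmx_delta -colE !mxE; apply.
by apply/eqP => /rowP/(_ i); rewrite !mxE !eqxx => /eqP; rewrite oner_eq0.
Qed.

End PosDef.

(** * Change of basis and the induced orientation *)

Section Orientation.
Variable R : realType.
Let p := pspace R.

Lemma linear_sum_coef (f : p -> R) (I : finType) (c : I -> R) (x : I -> p) :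
  (forall t u v, f (t *: u + v) = t * f u + f v) ->
  f (\sum_i c i *: x i) = \sum_i c i * f (x i).
Proof.
move=> fl; have f0 : f 0 = 0.
  by have := fl (-1) 0 0; rewrite scaler0 addr0 mulN1r addNr.
by elim/big_rec2: _ => // i u v _ <-; rewrite fl.
Qed.

Lemma G2_bilin_mx_basis (phi : kform p 3) (b : 'I_7 -> p) : is_kform phi ->
  let C := coord_mx b in
  G2_bilin_mx phi b = \det C *: (C *m G2_bilin_mx phi (@e R) *m C^T).
Proof.
move=> pk C; have [pl pa] := pk.
(* Once [top_form] has moved the evaluation from [b] to [e], at the price of [\det C], this scalar
   form remains; it is bilinear in [x] and [y]. *)
pose Om (x y : p) := kwedge (kwedge (kinterior x phi) (kinterior y phi)) phi (@e R).
have Oml y t u v : Om (t *: u + v) y = t * Om u y + Om v y.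
  rewrite /Om kinterior_linear //.
  rewrite -kwedge_linearl; congr (kwedge _ _ _); apply/funext => w.
  exact: kwedge_linearl.
have Omr x t u v : Om x (t *: u + v) = t * Om x u + Om x v.
  rewrite /Om kinterior_linear //.
  rewrite -kwedge_linearl; congr (kwedge _ _ _); apply/funext => w.
  exact: kwedge_linearr.
apply/matrixP => i j; rewrite !mxE.
have kk x : is_kform (kinterior x phi) by exact: is_kform_kinterior.
have Ok x y : is_kform (kwedge (kwedge (kinterior x phi) (kinterior y phi)) phi).
  by apply: is_kform_kwedge => //; exact: is_kform_kwedge.
rewrite (top_form _ (Ok _ _)) -/C; congr (_ * _); rewrite -/(Om _ _).
have Osuml x y : Om x y = \sum_k ecoord k x * Om (e R k) y.
  by rewrite -(linear_sum_coef (f := fun u => Om u y) _ _ (Oml y)) -ecoord_sum.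
have Osumr x y : Om x y = \sum_k ecoord k y * Om x (e R k).
  by rewrite -(linear_sum_coef (f := Om x) _ _ (Omr x)) -ecoord_sum.
rewrite Osuml.
under [RHS]eq_bigr do rewrite !mxE big_distrl.
rewrite exchange_big; apply: eq_bigr => k _ /=.
rewrite Osumr big_distrr /=.
apply: eq_bigr => l _; rewrite !mxE /Om.
by move: (kwedge _ _ _) => z; ring.
Qed.

(** A nonzero row vector killed by the coordinate matrix would be a second expansion of 0 in [b]. *)
Lemma vbasis_unit (b : 'I_7 -> p) : is_vbasis b -> coord_mx b \in unitmx.
Proof.
move=> bb; rewrite unitmxE unitfE; apply/negP => /det0P[v v0 vC].
have s0 : 0 = \sum_i v 0 i *: b i.
  rewrite [RHS]ecoord_sum big1 // => k _.
  rewrite (linear_sum_coef _ _ (f := ecoord k)); last by move=> *; exact: ecoord_linear.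
  have /rowP/(_ k) := vC; rewrite !mxE => h.
  rewrite (eq_bigr (fun i => v 0 i * coord_mx b i k)) ?h ?scale0r // => i _.
  by rewrite mxE.
have [c [_ cu]] := bb 0.
have c0 : c = 0 by apply: cu; rewrite big1 // => i _; rewrite mxE scale0r.
by move/cu: s0 => cv; rewrite -cv c0 eqxx in v0.
Qed.

(** Factoring out [a] isolates the sign of the bilinear form; definiteness and orientation are both
    read off from this factorisation. *)
Lemma G2_bilin_e_posdef (a : R) (M : 'M[R]_3) : 0 < a * \det M ->
  exists2 P, posdef_mx P & G2_bilin_mx (G2_form a M) (@e R) = a *: P.
Proof.
move=> aM; have [a0|a0] := eqVneq a 0; first by rewrite a0 mul0r ltxx in aM.
have Mu : M \in unitmx.
  by rewrite unitmxE unitfE; apply: contraTneq aM => ->; rewrite mulr0 ltxx.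
(* Since [a] and [\det M] have the same sign, their quotient is positive. *)
exists (block_mx ((6 * a ^+ 2) *: (M^T *m M)) 0 0 ((6 * (\det M / a)) *: 1%:M) : 'M_(3 + 4)).
  apply: (@posdef_block_mx _ 3 4); apply/posdef_mxZ.
  - exact: posdef_mx_gram.
  - by rewrite mulr_gt0 // exprn_even_gt0.
  - exact: posdef_mx1.
  - rewrite mulr_gt0 //; have -> : \det M / a = (a * \det M) / a ^+ 2 by field.
    by rewrite divr_gt0 // exprn_even_gt0.
rewrite G2_bilin_e (@scale_block_mx _ 3 4 3 4) !scaler0 !scalerA scale_scalar_mx mulr1.
have -> : a * (6 * a ^+ 2) = 6 * a ^+ 3 by ring.
by have -> : a * (6 * (\det M / a)) = 6 * \det M by field.
Qed.

Lemma G2_oriented_formE (a : R) (M : 'M[R]_3) (b : 'I_7 -> p) :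
  0 < a * \det M -> is_vbasis b ->
  G2_oriented (G2_form a M) b <-> 0 < a * \det (coord_mx b).
Proof.
move=> aM bb; have [P Pp BP] := G2_bilin_e_posdef aM.
have CP := posdef_mx_congr (vbasis_unit bb) Pp.
rewrite /G2_oriented G2_bilin_mx_basis; last exact: is_kform_G2_form.
rewrite BP -scalemxAr -scalemxAl scalerA mulrC.
by have := posdef_mxZ (a * \det (coord_mx b)) CP; tauto.
Qed.

End Orientation.

(** * Forms determined by components with increasing indices *)

Section SortedExt.
Variable R : realType.
Let p := pspace R.

(** A repeated index kills both values; otherwise sorting the indices multiplies both by the same
    sign, which cancels. *)
Lemma kform_ext_increasing k (w z : kform p k) : is_kform w -> is_kform z ->
  (forall s : 'I_k -> 'I_7, {homo s : i j / (i < j)%N} ->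
    w (fun i => e R (s i)) = z (fun i => e R (s i))) -> w = z.
Proof.
move=> wk zk wz; have [wl wa] := wk; have [zl za] := zk.
apply: multilinear_ext => // s.
have [/injectiveP sI|/injectivePn [i [j ij sij]]] := boolP (injectiveb s); last first.
  by rewrite (wa _ i j) ?sij // (za _ i j) ?sij.
pose u := [tuple s i | i < k].
have /tuple_permP[t ut] : perm_eq (sort (relpre val leq) u) u by rewrite perm_sort.
have E : (fun i => s (t i)) =
    (fun i => nth (s i) (sort (relpre val leq) u) i).
  apply/funext => i; have -> : nth (s i) (sort (relpre val leq) u) i =
     tnth [tuple tnth u (t i) | i < k] i by rewrite (tnth_nth (s i)) -ut.
  by rewrite !tnth_mktuple.
have st : {homo (fun i => s (t i)) : i j / (i < j)%N}.
  move=> i j ij; rewrite ltn_neqAle.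
  have -> : (s (t i) != s (t j) :> nat).
    rewrite (inj_eq val_inj) (inj_eq sI) (inj_eq perm_inj).
    by apply: contraTneq ij => ->; rewrite ltnn.
  have su : size (sort (relpre val leq) u) = k by rewrite size_sort size_tuple.
  have := congr1 (@^~ i) E; have := congr1 (@^~ j) E => /= -> ->.
  rewrite (set_nth_default (s j) (s i)) ?su //.
  apply: (sorted_ltn_nth (leT := relpre val leq)) => //; rewrite ?inE ?su //.
  - by move=> x y a /=; exact: leq_trans.
  - by apply: sort_sorted => x y; exact: leq_total.
have := wz _ st.
rewrite (kform_perm (fun i => e R (s i))) // (kform_perm (fun i => e R (s i))) //.
by apply: mulfI; rewrite signr_eq0.
Qed.

Lemma multilinear_scale (V : lmodType R) k (w : kform V k) (c : 'I_k -> R) (v : 'I_k -> V) :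
  multilinear w -> w (fun i => c i *: v i) = \prod_i c i * w v.
Proof.
move=> wl.
have H (s : seq 'I_k) : uniq s ->
    w (fun i => if i \in s then c i *: v i else v i) = \prod_(i <- s) c i * w v.
  elim: s => [|a s IH] /=; first by rewrite big_nil mul1r.
  case/andP=> as_ us; rewrite big_cons -mulrA -IH //.
  pose g : 'I_k -> V := fun i => if i \in s then c i *: v i else v i.
  (* The scaled argument is written as a one-term sum to fit [multilinear_sum]. *)
  have -> : (fun i => if i \in a :: s then c i *: v i else v i) =
      dfwith g a (\sum_(j < 1) c a *: v a).
    apply/funext => i; rewrite big_ord1 inE; case: (eqVneq i a) => [->|ia].
      by rewrite dfwithin.
    by rewrite dfwithout // eq_sym.
  rewrite multilinear_sum // big_ord1; congr (_ * w _); apply/funext => i.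
  case: (eqVneq a i) => [<-|ia]; last by rewrite dfwithout.
  by rewrite dfwithin (negPf as_).
rewrite -big_enum -H ?enum_uniq //; congr w; apply/funext => i.
by rewrite mem_enum.
Qed.

End SortedExt.

(** * Invariance of the family under Sp(1) *)

Section Invariance.
Variable R : realType.
Let p := pspace R.

Lemma pspace_ext (x y : p) : (forall n, (n < 7)%N -> pcoord n.+1 x = pcoord n.+1 y) -> x = y.
Proof.
move=> xy; rewrite (ecoord_sum x) (ecoord_sum y); apply: eq_bigr => i _.
by have := xy _ (ltn_ord i); rewrite /pcoord /= inord_val => ->.
Qed.

Lemma pcoordE (x : p) : [/\ pcoord 1 x = qi (p_val x 1 1), pcoord 2 x = qj (p_val x 1 1) &
     pcoord 3 x = qk (p_val x 1 1)] /\
  [/\ pcoord 4 x = 2 * isqrt2 R * qi (p_val x 0 1),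
      pcoord 5 x = 2 * isqrt2 R * qj (p_val x 0 1),
      pcoord 6 x = 2 * isqrt2 R * qk (p_val x 0 1) &
      pcoord 7 x = 2 * isqrt2 R * qre (p_val x 0 1)].
Proof.
by split; split; rewrite /pcoord ecoordE (tnth_nth 0) inordK.
Qed.

(** By [Ad_valE] the lower right entry is fixed and the upper right one is multiplied by [h] on the
    left; coordinates 4 to 7 are the i, j, k and real parts of the latter, up to the factor sqrt
    2. *)
Lemma pcoord_Ad (h : Sp1 R) (x : p) : let q : quat R := h in
  [/\ pcoord 1 (Ad h x) = pcoord 1 x, pcoord 2 (Ad h x) = pcoord 2 x &
     pcoord 3 (Ad h x) = pcoord 3 x] /\
  [/\ pcoord 4 (Ad h x) = qre q * pcoord 4 x + qi q * pcoord 7 x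
                          + qj q * pcoord 6 x - qk q * pcoord 5 x,
      pcoord 5 (Ad h x) = qre q * pcoord 5 x - qi q * pcoord 6 x
                          + qj q * pcoord 7 x + qk q * pcoord 4 x,
      pcoord 6 (Ad h x) = qre q * pcoord 6 x + qi q * pcoord 5 x
                          - qj q * pcoord 4 x + qk q * pcoord 7 x &
      pcoord 7 (Ad h x) = qre q * pcoord 7 x - qi q * pcoord 4 x
                          - qj q * pcoord 5 x - qk q * pcoord 6 x].
Proof.
move=> q; have [[-> -> ->] [-> -> -> ->]] := pcoordE x.
have [[-> -> ->] [-> -> -> ->]] := pcoordE (Ad h x).
have -> : p_val (Ad h x) = Ad_val h x by [].
rewrite Ad_valE !mxE /=; move: (isqrt2 R) => r.
split; first by split.
by split; rewrite ?quatE /=; rewrite -/q; ring.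
Qed.

Lemma Sp1_norm (h : Sp1 R) : let q : quat R := h in
  qre q ^+ 2 + qi q ^+ 2 + qj q ^+ 2 + qk q ^+ 2 = 1.
Proof.
move=> q; have /(congr1 (@qre R)) := sp1_valP h; rewrite ?quatE /= -/q => <-; ring.
Qed.

Lemma omega_val_Ad h r (u v : p) : omega_val r (Ad h u) (Ad h v) = omega_val r u v.
Proof.
(* Replacing 1 by the squared norm of [h] makes both sides homogeneous of degree 2 in [h], hence
   equal as polynomials. Behind it, each omega pairs a vector with a right multiple of another, and
   right multiplications commute with left ones. *)
rewrite -[RHS]mul1r -(Sp1_norm h).
case: r => [|[|r]]; rewrite /omega_val /coord_minor;
  have [_ [-> -> -> ->]] := pcoord_Ad h u; have [_ [-> -> -> ->]] := pcoord_Ad h v;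
  generalize (pcoord 4 u) (pcoord 5 u) (pcoord 6 u) (pcoord 7 u)
    (pcoord 4 v) (pcoord 5 v) (pcoord 6 v) (pcoord 7 v)
    (qre h) (qi h) (qj h) (qk h); intros; ring.
Qed.

Lemma pcoord_Ad_fixed h (i : 'I_3) (u : p) : pcoord i.+1 (Ad h u) = pcoord i.+1 u.
Proof. by have [[? ? ?] _] := pcoord_Ad h u; case: i => [[|[|[|//]]]]. Qed.

Lemma row_form_Ad h (M : 'M[R]_3) r (u : p) : row_form M r (Ad h u) = row_form M r u.
Proof.
by rewrite /row_form; apply: eq_bigr => i _; rewrite pcoord_Ad_fixed.
Qed.

Lemma G2_form_invariant a M : Ad_invariant (@G2_form R a M).
Proof.
move=> h v.
have E (w : 'I_3 -> p) : G2_form a M w = form_at (G2_form a M) (fun n => w (inord n)).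
  by congr (G2_form _ _ _); apply/funext => i; rewrite inord_val.
rewrite !E !form_at_G2_form /=; congr (_ * _ + _).
  rewrite /coord_minor.
  have [[-> -> ->] _] := pcoord_Ad h (v (inord 0)).
  have [[-> -> ->] _] := pcoord_Ad h (v (inord 1)).
  by have [[-> -> ->] _] := pcoord_Ad h (v (inord 2)).
by apply: eq_bigr => r _; rewrite !omega_val_Ad !row_form_Ad.
Qed.

End Invariance.

(** * Real odd roots *)

Lemma oddrootK (R : realType) n (x : R) : odd n -> oddroot n x ^+ n = x.
Proof.
move=> on; have n0 : n%:R != 0 :> R by rewrite pnatr_eq0; case: n on.
rewrite /oddroot exprMn -[X in _ * X]powR_mulrn ?powR_ge0 // -powRrM mulVf // powRr1 //.
have [x0|x0|->] := ltrgt0P x; last by rewrite sgr0 mulr0.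
  by rewrite gtr0_sg // expr1n mul1r.
by rewrite ltr0_sg // -signr_odd on expr1 mulN1r opprK.
Qed.

Lemma oddrootX (R : realType) n (x : R) : odd n -> oddroot n (x ^+ n) = x.
Proof.
move=> on; have n0 : n%:R != 0 :> R by rewrite pnatr_eq0; case: n on.
rewrite /oddroot normrX sgrX.
rewrite -(powR_mulrn n (normr_ge0 x)) -powRrM mulfV // powRr1 //.
have [x0|x0|->] := ltrgt0P x; last by rewrite mulr0.
  by rewrite gtr0_sg // expr1n mul1r.
by rewrite ltr0_sg // -signr_odd on expr1 mulN1r opprK.
Qed.

(** * Classification of the invariant 3-forms *)

Section Classification.
Variable R : realType.
Let p := pspace R.

Lemma Sp1_i_subproof : quat_i R * quat_conj (quat_i R) = 1.
Proof. by apply: quat_ext; rewrite ?quatE /=; ring. Qed.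
Lemma Sp1_j_subproof : quat_j R * quat_conj (quat_j R) = 1.
Proof. by apply: quat_ext; rewrite ?quatE /=; ring. Qed.
Lemma Sp1_N1_subproof : - 1 * quat_conj (- 1) = 1 :> quat R.
Proof. by apply: quat_ext; rewrite ?quatE /=; ring. Qed.

Definition Sp1_i := MkSp1 Sp1_i_subproof.
Definition Sp1_j := MkSp1 Sp1_j_subproof.
Definition Sp1_N1 := MkSp1 Sp1_N1_subproof.

Definition component3 (w : kform p 3) (i j k : nat) : R :=
  form_at w (fcons (e0 R i) (fcons (e0 R j) (fun=> e0 R k))).

(** Turns invariance under an element that permutes the basis up to scalars into linear relations
    between components, in a form that [lra] can use. *)
Lemma component3_Ad (w : kform p 3) (h : Sp1 R) (c : nat -> R) (s : nat -> nat) :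
  multilinear w -> Ad_invariant w ->
  (forall i, (i < 7)%N -> Ad h (e0 R i) = c i *: e0 R (s i)) ->
  forall i j k, (i < 7)%N -> (j < 7)%N -> (k < 7)%N ->
  component3 w i j k = c i * c j * c k * component3 w (s i) (s j) (s k).
Proof.
move=> wl wi hE i j k i7 j7 k7; rewrite /component3 /form_at -(wi h).
pose d := fcons i (fcons j (fun=> k)).
rewrite (_ : (fun _ => Ad _ _) = fun l : 'I_3 => c (d l) *: e0 R (s (d l))).
  rewrite (multilinear_scale (fun l : 'I_3 => c (d l))) //.
  rewrite !big_ord_recl big_ord0 /d /= mulr1 !mulrA.
  by congr (_ * w _); apply/funext => -[[|[|[|//]]]].
by apply/funext => -[[|[|[|//]]] hl] /=; rewrite hE.
Qed.

(** Restores the increasing order of the last two indices, which [perm_i] and [perm_j] may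
    reverse. *)
Lemma component3_swap23 (w : kform p 3) i j k : is_kform w ->
  component3 w i k j = - component3 w i j k.
Proof.
move=> wk; rewrite /component3 /form_at -(kform_tperm _ wk (i := inord 1) (j := inord 2)).
  congr w; apply/funext => l; case: tpermP => [->|->|]; rewrite ?inordK //.
  case: l => [[|[|[|//]]] hl] // l1 l2; [case: l1|case: l2];
    by apply: val_inj; rewrite /= inordK.
by rewrite -val_eqE /= !inordK.
Qed.

Lemma pcoordZ n t (x : p) : pcoord n (t *: x) = t * pcoord n x.
Proof. by rewrite /pcoord -[t *: x]addr0 ecoord_linear ecoord0 addr0. Qed.

(* The indices 3, 4, 5, 6 stand for the units i, j, k, 1 of the off-diagonal
   quaternion, which Sp(1) multiplies on the left. *)
Definition perm_i (i : nat) := match i with 3 => 6 | 4 => 5 | 5 => 4 | 6 => 3 | n => n end.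
Definition sign_i (i : nat) : R := match i with 3 | 5 => -1 | _ => 1 end.
Definition perm_j (i : nat) := match i with 3 => 5 | 4 => 6 | 5 => 3 | 6 => 4 | n => n end.
Definition sign_j (i : nat) : R := match i with 3 | 4 => -1 | _ => 1 end.

Lemma Ad_e0 i : (i < 7)%N ->
  [/\ Ad Sp1_N1 (e0 R i) = (if (i < 3)%N then 1 else -1) *: e0 R i,
      Ad Sp1_i (e0 R i) = sign_i i *: e0 R (perm_i i) &
      Ad Sp1_j (e0 R i) = sign_j i *: e0 R (perm_j i)].
Proof.
move=> i7; split; apply: pspace_ext => n n7; rewrite pcoordZ pcoord_e0 //.
- have [[E1 E2 E3] [E4 E5 E6 E7]] := pcoord_Ad Sp1_N1 (e0 R i).
  case: n n7 => [|[|[|[|[|[|[|//]]]]]]] _;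
    rewrite ?E1 ?E2 ?E3 ?E4 ?E5 ?E6 ?E7 ?quatE /= !pcoord_e0 //;
  by case: i i7 {E1 E2 E3 E4 E5 E6 E7} => [|[|[|[|[|[|[|//]]]]]]] _ /=; ring.
- have [[E1 E2 E3] [E4 E5 E6 E7]] := pcoord_Ad Sp1_i (e0 R i).
  case: n n7 => [|[|[|[|[|[|[|//]]]]]]] _;
    rewrite ?E1 ?E2 ?E3 ?E4 ?E5 ?E6 ?E7 ?quatE /= !pcoord_e0 //;
  by case: i i7 {E1 E2 E3 E4 E5 E6 E7} => [|[|[|[|[|[|[|//]]]]]]] _ /=; ring.
- have [[E1 E2 E3] [E4 E5 E6 E7]] := pcoord_Ad Sp1_j (e0 R i).
  case: n n7 => [|[|[|[|[|[|[|//]]]]]]] _;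
    rewrite ?E1 ?E2 ?E3 ?E4 ?E5 ?E6 ?E7 ?quatE /= !pcoord_e0 //;
  by case: i i7 {E1 E2 E3 E4 E5 E6 E7} => [|[|[|[|[|[|[|//]]]]]]] _ /=; ring.
Qed.

Lemma invariant_kformE (w : kform p 3) : is_kform w -> Ad_invariant w ->
  exists (a : R) (M : 'M[R]_3), w = G2_form a M.
Proof.
move=> wk wi; have [wl wa] := wk.
(* Invariance under -1 kills the components with an odd number of indices in 3..6;
   i and j identify the other ones. *)
have RN := component3_Ad (c := fun i => if (i < 3)%N then 1 else -1) (s := id) wl wi
  (fun i i7 => let: And3 H _ _ := Ad_e0 i7 in H).
have Ri := component3_Ad (c := sign_i) (s := perm_i) wl wi
  (fun i i7 => let: And3 _ H _ := Ad_e0 i7 in H).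
have Rj := component3_Ad (c := sign_j) (s := perm_j) wl wi
  (fun i i7 => let: And3 _ _ H := Ad_e0 i7 in H).
have S i j k := @component3_swap23 w i j k wk.
(* One component represents each omega: those of e^47, e^46 and e^45 in the 1-based numbering. *)
pose m r i := match r with
  | 0 => component3 w i 3 6 | 1 => component3 w i 3 5 | _ => component3 w i 3 4 end.
(* A cube root, since the coefficient of e^123 in [G2_form] is [a ^+ 3]. *)
exists (oddroot 3 (component3 w 0 1 2)), (\matrix_(r, i) m r i).
apply: kform_ext_increasing => //; first exact: is_kform_G2_form.
move=> s sI; pose u n := val (s (inord n)).
have E : (fun i => e R (s i)) = (fun i => e0 R (u i)).
  by apply/funext => i; rewrite /e0 /u !inord_val ltn_ord.
rewrite E -[RHS]/(form_at (G2_form _ _) (e0 R \o u)) form_at_G2_form_e0.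
have -> : w (fun i => e0 R (u i)) = component3 w (u 0%N) (u 1%N) (u 2%N).
  by congr w; apply/funext => -[[|[|[|//]]]].
rewrite oddrootK //.
have u01 : (u 0 < u 1)%N by apply: sI; rewrite !inordK.
have u12 : (u 1 < u 2)%N by apply: sI; rewrite !inordK.
have u7 : (u 2 < 7)%N by exact: ltn_ord.
rewrite /alt3 u01 u12.
have ME r i : (r < 3)%N -> (i < 3)%N -> mxentry (\matrix_(r < 3, i < 3) m r i) r i = m r i.
  by move=> r3 i3; rewrite /mxentry mxE !inordK.
move: (u 0%N) (u 1%N) (u 2%N) u01 u12 u7 => i j k ij jk k7.
have j7 := ltn_trans jk k7; have i7 := ltn_trans ij j7.
have := RN i j k i7 j7 k7; have := Ri i j k i7 j7 k7; have := Rj i j k i7 j7 k7.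
case: i ij i7 => [|[|[|[|[|[|[|//]]]]]]] ij _;
  case: j ij jk j7 => [|[|[|[|[|[|[|//]]]]]]] // _ jk _;
  case: k jk k7 => [|[|[|[|[|[|[|//]]]]]]] // _ _;
  rewrite /= ?ME //= ?(S _ 3 5) ?(S _ 3 6) ?(S _ 4 6) ?(S _ 4 5) //=; lra.
Qed.
End Classification.

(** * The definiteness condition and the induced metric *)

Section Metric.
Variable R : realType.
Let p := pspace R.

Lemma G2_structure_formE (a : R) (M : 'M[R]_3) :
  G2_structure (G2_form a M) <-> 0 < a * \det M.
Proof.
split=> [[_]|aM]; last first.
  split; first exact: is_kform_G2_form.
  have [P Pp ->] := G2_bilin_e_posdef aM.
  have [a0|a0|a0] := ltrgt0P a; last by rewrite a0 mul0r ltxx in aM.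
    by left; apply/(posdef_mxZ (n := 6)).
  by right; rewrite -scaleNr; apply/(posdef_mxZ (n := 6)); rewrite // oppr_gt0.
(* One diagonal entry per block is enough: this one is nonnegative, so its block reveals the sign of
   [a ^+ 3], and the other block that of [\det M]. *)
have M0 : 0 <= (M^T *m M) 0 0.
  by rewrite mxE sumr_ge0 // => i _; rewrite mxE -expr2 sqr_ge0.
have B00 : G2_bilin_mx (G2_form a M) (@e R) (lshift 4 (0 : 'I_3)) (lshift 4 (0 : 'I_3)) =
    6 * a ^+ 3 * (M^T *m M) 0 0.
  by rewrite G2_bilin_e (@block_mxEul _ 3 4 3 4) mxE.
have B33 : G2_bilin_mx (G2_form a M) (@e R) (rshift 3 (0 : 'I_4)) (rshift 3 (0 : 'I_4)) =
    6 * \det M.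
  by rewrite G2_bilin_e (@block_mxEdr _ 3 4 3 4) mxE eqxx mulr1n.
case=> Bp; have := posdef_mx_diag (lshift 4 (0 : 'I_3)) Bp;
  have := posdef_mx_diag (rshift 3 (0 : 'I_4)) Bp.
  rewrite B00 B33 => d0 a0; apply: mulr_gt0; last by lra.
  by rewrite -(@exprn_odd_gt0 _ 3) // ltNge;
  apply: contraTN a0 => a0; rewrite -leNgt; nra.
have oppE (A : 'M[R]_7) i : (- A) i i = - A i i by rewrite mxE.
rewrite !oppE B00 B33 => d0 a0; rewrite -mulrNN; apply: mulr_gt0; last by lra.
by rewrite oppr_gt0 -(@exprn_odd_lt0 _ 3) // ltNge;
  apply: contraTN a0 => a0; rewrite -leNgt; nra.
Qed.

Lemma invariant_G2_structureE (phi : kform p 3) :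
  G2_structure phi /\ Ad_invariant phi <->
  exists (a : R) (M : 'M[R]_3), phi = G2_form a M /\ 0 < a * \det M.
Proof.
split=> [[phiG phiA]|[a [M [-> aM]]]].
  have [phik _] := phiG; have [a [M phiE]] := invariant_kformE phik phiA.
  by exists a, M; split=> //; apply/G2_structure_formE; rewrite -phiE.
by split; [apply/G2_structure_formE|exact: G2_form_invariant].
Qed.

(** The radicand is the determinant of the Gram matrix. With [s] the ninth root of 6 and [x] the
    cube root of [d], it is the ninth power of [s ^+ 7 * a * x ^+ 2]; the prefactor [s ^- 2]
    completes [s ^+ 7] to [s ^+ 9 = 6]. *)
Lemma oddroot9_det (a d : R) : a != 0 ->
  6 `^ (- (2 / 9)) / oddroot 9 (6 ^+ 7 * a ^+ 9 * d ^+ 6) =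
  (6 * a * oddroot 3 d ^+ 2)^-1.
Proof.
move=> a0; pose s : R := 6 `^ (9^-1).
have s0 : 0 < s by rewrite powR_gt0.
have s9 : s ^+ 9 = 6.
  by rewrite -powR_mulrn ?powR_ge0 // -powRrM mulVf ?pnatr_eq0 // powRr1 ?ler0n.
have -> : 6 `^ (- (2 / 9)) = s ^- 2 :> R.
  by rewrite powRN mulrC powRrM powR_mulrn // ltW.
have d3 : oddroot 3 d ^+ 3 = d by exact: oddrootK.
rewrite -{1}d3 -exprM; move: (oddroot 3 d) => x.
have -> : 6 ^+ 7 * a ^+ 9 * x ^+ (3 * 6) = (s ^+ 7 * a * x ^+ 2) ^+ 9.
  by rewrite -s9; ring.
rewrite oddrootX //.
by rewrite -s9 -invfM; congr (_^-1); ring.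
Qed.

Lemma G2_metric_formE (a : R) (M : 'M[R]_3) : 0 < a * \det M ->
  G2_metric (G2_form a M) = (a ^+ 2 / oddroot 3 (\det M) ^+ 2) *:
    block_mx (M^T *m M) 0 0 ((\det M / a ^+ 3)%:M : 'M[R]_4) :> 'M_(3 + 4).
Proof.
move=> aM; have a0 : a != 0 by apply: contraTneq aM => ->; rewrite mul0r ltxx.
have d0 : \det M != 0 by apply: contraTneq aM => ->; rewrite mulr0 ltxx.
rewrite /G2_metric G2_bilin_e (@det_ublock _ 3 4) det_scalar detZ det_mulmx det_tr.
have -> : (6 * a ^+ 3) ^+ 3 * (\det M * \det M) * (6 * \det M) ^+ 4 =
  6 ^+ 7 * a ^+ 9 * \det M ^+ 6 by ring.
rewrite oddroot9_det //.
have r0 : oddroot 3 (\det M) != 0.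
  by apply: contra_neq d0 => r0; rewrite -(@oddrootK _ 3 (\det M)) // r0 expr0n.
move: (oddroot 3 _) r0 => r r0.
rewrite !(@scale_block_mx _ 3 4 3 4) !scaler0 scalerA !scale_scalar_mx.
have -> : (6 * a * r ^+ 2)^-1 * (6 * a ^+ 3) = a ^+ 2 / r ^+ 2.
  by field; rewrite a0 r0.
have -> // : (6 * a * r ^+ 2)^-1 * (6 * \det M) = a ^+ 2 / r ^+ 2 * (\det M / a ^+ 3).
by field; rewrite a0 r0.
Qed.

Lemma bilin_mx_block (G : 'M[R]_3) (t : R) (u v : p) :
  bilin_mx (block_mx G 0 0 (t%:M : 'M_4) : 'M_(3 + 4)) u v =
  \sum_(i < 3) \sum_(j < 3) pcoord i.+1 u * G i j * pcoord j.+1 v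
  + t * (pcoord 4 u * pcoord 4 v + pcoord 5 u * pcoord 5 v
         + pcoord 6 u * pcoord 6 v + pcoord 7 u * pcoord 7 v).
Proof.
have El (i : 'I_3) w : ecoord (lshift 4 i : 'I_7) w = pcoord i.+1 w.
  by rewrite /pcoord /=; congr (ecoord _ w); apply: val_inj;
    rewrite /= inordK // (leq_trans (ltn_ord i)).
have Er (i : 'I_4) w : ecoord (rshift 3 i : 'I_7) w = pcoord i.+4 w.
  by rewrite /pcoord /=; congr (ecoord _ w); apply: val_inj;
    rewrite /= inordK // (ltn_add2l 3 i 4).
rewrite /bilin_mx (@big_split_ord _ _ _ 3 4) /=; congr (_ + _).
  apply: eq_bigr => i _; rewrite (@big_split_ord _ _ _ 3 4) /= [X in _ + X]big1 ?addr0.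
    by apply: eq_bigr => j _; rewrite !El (@block_mxEul _ 3 4 3 4).
  by move=> j _; rewrite (@block_mxEur _ 3 4 3 4) mxE mulr0 mul0r.
transitivity (\sum_(i < 4) t * (pcoord i.+4 u * pcoord i.+4 v)).
  apply: eq_bigr => i _; rewrite (@big_split_ord _ _ _ 3 4) /= big1 ?add0r.
    rewrite (bigD1 i) //= big1 ?addr0 => [|j ji].
      by rewrite !Er (@block_mxEdr _ 3 4 3 4) mxE eqxx mulr1n; ring.
    by rewrite (@block_mxEdr _ 3 4 3 4) mxE eq_sym (negPf ji) mulr0n mulr0 mul0r.
  by move=> j _; rewrite (@block_mxEdl _ 3 4 3 4) mxE mulr0 mul0r.
by rewrite -mulr_sumr !big_ord_recl big_ord0 /= addr0 !addrA.
Qed.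

Lemma bilin_mx_block_Ad (G : 'M[R]_3) (t : R) h (u v : p) :
  let g := block_mx G 0 0 (t%:M : 'M_4) : 'M_(3 + 4) in
  bilin_mx g (Ad h u) (Ad h v) = bilin_mx g u v.
Proof.
rewrite /= !bilin_mx_block; congr (_ + _ * _).
  by apply: eq_bigr => i _; apply: eq_bigr => j _; rewrite !pcoord_Ad_fixed.
rewrite -[RHS]mul1r -(Sp1_norm h).
have [_ [-> -> -> ->]] := pcoord_Ad h u; have [_ [-> -> -> ->]] := pcoord_Ad h v.
generalize (pcoord 4 u) (pcoord 5 u) (pcoord 6 u) (pcoord 7 u)
    (pcoord 4 v) (pcoord 5 v) (pcoord 6 v) (pcoord 7 v)
  (qre h) (qi h) (qj h) (qk h); intros; ring.
Qed.

Lemma G2_metric_inner_product (a : R) (M : 'M[R]_3) : 0 < a * \det M ->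
  invariant_inner_product (G2_metric (G2_form a M)).
Proof.
move=> aM; rewrite G2_metric_formE //.
have a0 : a != 0 by apply: contraTneq aM => ->; rewrite mul0r ltxx.
have d0 : \det M != 0 by apply: contraTneq aM => ->; rewrite mulr0 ltxx.
set c := _ / _; have c0 : 0 < c.
  rewrite divr_gt0 ?exprn_even_gt0 //=.
  by apply: contra_neq d0 => r0; rewrite -(@oddrootK _ 3 (\det M)) // r0 expr0n.
have t0 : 0 < \det M / a ^+ 3.
  have -> : \det M / a ^+ 3 = a * \det M / a ^+ 4 by field.
  by rewrite divr_gt0 // exprn_even_gt0.
have Mu : M \in unitmx by rewrite unitmxE unitfE.
rewrite (@scale_block_mx _ 3 4 3 4) !scaler0 scale_scalar_mx.
split.
- rewrite (@tr_block_mx _ 3 4 3 4) !trmx0 tr_scalar_mx.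
  by rewrite linearZ /= trmx_mul trmxK.
- apply: (@posdef_block_mx _ 3 4).
    by apply/(posdef_mxZ (n := 2)) => //; exact: posdef_mx_gram.
  rewrite -scalemx1; apply/(posdef_mxZ (n := 3)); first exact: posdef_mx1.
  exact: mulr_gt0.
- by move=> h u v; exact: bilin_mx_block_Ad.
Qed.

(** Translates the block found in terms of D^-1 into the inverse of D D^t. *)
Lemma invmx_gramV n (M : 'M[R]_n) : M \in unitmx ->
  invmx (invmx M *m (invmx M)^T) = M^T *m M.
Proof.
move=> Mu; have Vu : invmx M \in unitmx by rewrite unitmx_inv.
have VTu : (invmx M)^T \in unitmx by rewrite unitmx_tr.
have U : invmx M *m (invmx M)^T \in unitmx by rewrite unitmx_mul Vu.
apply: (can_inj (mulKmx U)); rewrite mulmxV // mulmxA -[_ *m _ *m M^T]mulmxA -trmx_mul.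
by rewrite mulmxV // trmx1 mulmx1 mulVmx.
Qed.

End Metric.

(** * Open subsets of linear images as manifolds *)

Section LinearImage.
Variable R : realType.

Lemma C_k_cst (V W : normedModType R) k (U : set V) (w : W) : C_k k U (fun=> w).
Proof.
elim: k w => [|k IH] w; first by move=> x _; exact: cst_continuous.
split=> [x _|v]; first exact: differentiable_cst.
have -> : (fun x : V => 'd (fun=> w) x v) = (fun=> 0) by apply/funext => x; rewrite diff_cst.
exact: IH.
Qed.

Lemma continuous_lincomb (T : topologicalType) (V : normedModType R) (I : finType)
    (c : I -> T -> R) (v : I -> V) :
  (forall i, continuous (c i)) -> continuous (fun x => \sum_i c i x *: v i).
Proof.
move=> cc; suff H (s : seq I) : continuous (fun x => \sum_(i <- s) c i x *: v i) by exact: H.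
elim: s => [|i s IH].
  under eq_fun do rewrite big_nil; exact: cst_continuous.
under eq_fun do rewrite big_cons.
by move=> x; apply: cvgD; [apply: cvgZr_tmp; exact: cc|exact: IH].
Qed.

Lemma continuous_row (T : topologicalType) n (c : 'I_n -> T -> R) :
  (forall i, continuous (c i)) -> continuous (fun x => \row_i c i x : 'rV[R]_n).
Proof.
move=> cc; rewrite (_ : (fun x => _) = fun x => \sum_i c i x *: delta_mx 0 i).
  exact: continuous_lincomb.
apply/funext => x; rewrite [LHS]row_sum_delta.
by apply: eq_bigr => i _; rewrite mxE.
Qed.

(** [L] itself is a chart around every point. Its left inverse [P] makes its constant differential
    injective, and by continuity of [P] the image of an open [U] is the trace on [L @]
    O[of the open set]P @^-1[U]. *)
Lemma linear_image_manifold (V : normedModType R) n (L : 'rV[R]_n -> V)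
    (P : V -> 'rV[R]_n) (O : set 'rV[R]_n) :
  linear L -> continuous P -> cancel L P -> open O -> O !=set0 ->
  has_manifold_dim (L @` O) n.
Proof.
move=> Llin Pc LK Oo [x0 Ox0].
pose Lm := GRing.isLinear.Build _ _ _ _ L Llin.
pose LL : {linear 'rV[R]_n -> V} := HB.pack L Lm.
have Lc : continuous LL.
  have -> : (LL : _ -> _) = (fun x : 'rV_n => \sum_i x 0 i *: LL (delta_mx 0 i)).
    apply/funext => x; rewrite {1}[x]row_sum_delta linear_sum.
    by apply: eq_bigr => i _; rewrite linearZ.
  by apply: continuous_lincomb => i; exact: coord_continuous.
have Ld x : 'd L x = L :> (_ -> _) by exact: (diff_lin (f := LL)).
split; first by exists (L x0), x0.
move=> _ [x Ox <-]; exists O, L; split.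
- by split=> //; exists x.
- case=> [|k]; first by move=> y _; exact: Lc.
  split=> [y _|v]; first exact: (linear_differentiable (f := LL)).
  have -> : (fun y => 'd L y v) = (fun=> L v) by apply/funext => y; rewrite Ld.
  exact: C_k_cst.
- by move=> y _; rewrite Ld; exact: can_inj LK.
- by move=> y z _ _; exact: can_inj LK _ _.
move=> U Uo UO; exists (P @^-1` U); first by apply: open_comp => // y _; exact: Pc.
apply/seteqP; split=> [_ [y Uy <-]|_ [[y Oy <-]]] /=.
  by split; [exists y => //; exact: UO|rewrite /= LK].
by rewrite LK => Uy; exists y.
Qed.

End LinearImage.

Lemma continuous_mul (R : realType) (T : topologicalType) (f g : T -> R) :
  continuous f -> continuous g -> continuous (fun x => f x * g x).
Proof. by move=> fc gc x; apply: cvgM; [exact: fc|exact: gc]. Qed.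

Lemma continuous_add (R : realType) (T : topologicalType) (f g : T -> R) :
  continuous f -> continuous g -> continuous (fun x => f x + g x).
Proof. by move=> fc gc x; apply: cvgD; [exact: fc|exact: gc]. Qed.

Lemma continuous_sub (R : realType) (T : topologicalType) (f g : T -> R) :
  continuous f -> continuous g -> continuous (fun x => f x - g x).
Proof. by move=> fc gc x; apply: cvgB; [exact: fc|exact: gc]. Qed.

(** * Dimension of the space of invariant structures *)

Section FormManifold.
Variable R : realType.
Let p := pspace R.

Definition coef_mx (x : 'rV[R]_10) : 'M[R]_3 := \matrix_(r, i) x 0 (inord (1 + 3 * r + i)).

(* The coordinate [x 0 0] is [a ^+ 3] rather than [a], which makes the
   parametrisation linear. *)
Definition form_of_row (x : 'rV[R]_10) : kform p 3 := G2_form (oddroot 3 (x 0 0)) (coef_mx x).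

(** The triples at which the ten coordinates reappear as components: e^123, then e^i47, e^i46 and
    e^i45 in the 1-based numbering. *)
Definition row_index (j : 'I_10) : {ffun 'I_3 -> 'I_7} :=
  let t := nth (0, 1, 2)%N [:: (0, 1, 2); (0, 3, 6); (1, 3, 6); (2, 3, 6); (0, 3, 5);
    (1, 3, 5); (2, 3, 5); (0, 3, 4); (1, 3, 4); (2, 3, 4)]%N j in
  [ffun k : 'I_3 => inord (nth 0%N [:: t.1.1; t.1.2; t.2] k)].

Definition row_of_components (A : 'rV[R]_#|{ffun 'I_3 -> 'I_7}|) : 'rV[R]_10 :=
  \row_j A 0 (enum_rank (row_index j)).

Lemma form_of_row_e (x : 'rV[R]_10) (s : 'I_3 -> 'I_7) :
  form_of_row x (fun i => e R (s i)) =
  alt3 (G2_coef (x 0 0) (mxentry (coef_mx x))) (s 0) (s 1) (s (inord 2)).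
Proof.
pose u n := val (s (inord n)).
have -> : (fun i => e R (s i)) = (fun i => e0 R (u i)).
  by apply/funext => i; rewrite /e0 /u !inord_val ltn_ord.
rewrite -[LHS]/(form_at (form_of_row x) (e0 R \o u)) form_at_G2_form_e0 oddrootK // /u.
have -> : inord 0 = 0 :> 'I_3 by apply: val_inj; rewrite /= inordK.
by have -> : inord 1 = 1 :> 'I_3 by apply: val_inj; rewrite /= inordK.
Qed.

Lemma alt3_linear (T1 T2 T : nat -> nat -> nat -> R) t i j k :
  (forall i j k, T i j k = t * T1 i j k + T2 i j k) ->
  alt3 T i j k = t * alt3 T1 i j k + alt3 T2 i j k.
Proof. by move=> E; rewrite /alt3; do !case: ifP => _; rewrite !E; ring. Qed.

Lemma components_linear : linear (@kform_components R 3 \o form_of_row).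
Proof.
move=> t x y; apply/rowP => s; rewrite !mxE.
rewrite -[LHS]/(form_of_row (t *: x + y) (fun i => e R ((enum_val s : {ffun _ -> _}) i))).
rewrite !form_of_row_e; apply: alt3_linear => i j k.
have E r l : mxentry (coef_mx (t *: x + y)) r l =
    t * mxentry (coef_mx x) r l + mxentry (coef_mx y) r l by rewrite /mxentry !mxE.
have E0 : (t *: x + y) 0 0 = t * x 0 0 + y 0 0 by rewrite !mxE.
by case: i => [|[|[|i]]]; case: j => [|[|[|[|[|[|j]]]]]]; case: k => [|[|[|[|[|[|[|k]]]]]]];
  rewrite /= ?E0 ?E; ring.
Qed.

Lemma row_of_componentsK :
  cancel (@kform_components R 3 \o form_of_row) row_of_components.
Proof.
move=> x; apply/rowP => j; rewrite !mxE enum_rankK.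
rewrite form_of_row_e !ffunE.
have -> : (inord 2 : 'I_3) = 2%N :> nat by rewrite inordK.
have mE r i : (r < 3)%N -> (i < 3)%N -> mxentry (coef_mx x) r i = x 0 (inord (1 + 3 * r + i)).
  by move=> r3 i3; rewrite /mxentry mxE !inordK.
case: j => [[|[|[|[|[|[|[|[|[|[|//]]]]]]]]]] hj]; rewrite /= !inordK //= /alt3 /= ?mE //;
  by congr (x 0 _); apply: val_inj; rewrite //= inordK.
Qed.

Lemma continuous_row_of_components : continuous row_of_components.
Proof. by apply: continuous_row => j; exact: coord_continuous. Qed.

Definition form_domain : set 'rV[R]_10 := [set x : 'rV[R]_10 | 0 < x 0 0 * \det (coef_mx x)].

Lemma continuous_det3 (T : topologicalType) (M : T -> 'M[R]_3) :
  (forall i j, continuous (fun x => M x i j)) -> continuous (fun x => \det (M x)).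
Proof.
move=> Mc; have mc r i : continuous (fun x => mxentry (M x) r i) by exact: Mc.
under eq_fun do rewrite det3E.
apply: continuous_add; first apply: continuous_sub.
all: by apply: continuous_mul => //; apply: continuous_sub; exact: continuous_mul.
Qed.

Lemma open_form_domain : open form_domain.
Proof.
apply: (open_comp (f := fun x : 'rV[R]_10 => x 0 0 * \det (coef_mx x))
  (D := [set t | 0 < t])); last exact: open_gt.
move=> x _; apply: continuous_mul; first exact: coord_continuous.
apply: continuous_det3 => i j.
rewrite (_ : (fun x => _) = fun x : 'rV[R]_10 => x 0 (inord (1 + 3 * i + j))).
  exact: coord_continuous.
by apply/funext => y; rewrite mxE.
Qed.

Lemma invariant_G2_structures_image :
  @kform_components R 3 @` @invariant_G2_structures R =
  (@kform_components R 3 \o form_of_row) @` form_domain.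
Proof.
apply/seteqP; split=> [_ [phi /invariant_G2_structureE[a [M [-> aM]]] <-]|_ [x x0 <-]].
  pose x : 'rV[R]_10 := \row_j if j == 0 then a ^+ 3 else mxentry M (j.-1 %/ 3) (j.-1 %% 3).
  have xM : coef_mx x = M.
    apply/matrixP => r i; rewrite !mxE.
    have ri : (1 + 3 * r + i < 10)%N.
      by case: r i => [[|[|[|//]]] ?] [[|[|[|//]]] ?].
    rewrite -val_eqE /= inordK // add1n /= mulnC.
    rewrite divnMDl // modnMDl divn_small // modn_small // addn0.
    by rewrite /mxentry !inord_val.
  have x00 : x 0 0 = a ^+ 3 by rewrite mxE eqxx.
  exists x; last by rewrite /= /form_of_row xM x00 oddrootX.
  (* Passing from [a] to [a ^+ 3] multiplies the condition by [a ^+ 2], which is positive. *)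
  rewrite /form_domain /= xM x00 exprS -mulrA mulrCA mulr_gt0 // exprn_even_gt0 //=.
  by apply: contraTneq aM => ->; rewrite mul0r ltxx.
exists (form_of_row x) => //; apply/invariant_G2_structureE.
exists (oddroot 3 (x 0 0)), (coef_mx x); split=> //.
move: x0; rewrite /form_domain /= -{1}(@oddrootK _ 3 (x 0 0)) //.
move: (oddroot _ _) (\det _) => a d ad; have a0 : a != 0.
  by apply: contraTneq ad => ->; rewrite expr0n mul0r ltxx.
have a2 : 0 < a ^+ 2 by rewrite exprn_even_gt0.
by rewrite -(pmulr_rgt0 _ a2) mulrA -exprSr.
Qed.

Lemma invariant_forms_manifold :
  has_manifold_dim (@kform_components R 3 @` @invariant_G2_structures R) 10.
Proof.
rewrite invariant_G2_structures_image.
apply: (linear_image_manifold components_linear continuous_row_of_components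
  row_of_componentsK open_form_domain).
have d1 : 0 < 1 * \det (1%:M : 'M[R]_3) by rewrite det1 mul1r.
have : (@kform_components R 3 @` @invariant_G2_structures R) !=set0.
  exists (kform_components (G2_form 1 1%:M)), (G2_form 1 1%:M) => //.
  by apply/invariant_G2_structureE; exists 1, 1%:M.
by rewrite invariant_G2_structures_image => -[_ [x xO _]]; exists x.
Qed.

End FormManifold.

(** * Dimension of the space of induced metrics *)

Section MetricManifold.
Variable R : realType.
Let p := pspace R.

Definition sym3 (x : nat -> R) (i j : nat) : R :=
  match i, j with
  | 0, 0 => x 0%N
  | 0, 1 | 1, 0 => x 1%N
  | 0, 2 | 2, 0 => x 2%N
  | 1, 1 => x 3%N
  | 1, 2 | 2, 1 => x 4%N
  | _, _ => x 5%N
  end.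

Definition rowentry (x : 'rV[R]_7) (i : nat) : R := x 0 (inord i).

Definition sym_mx (x : 'rV[R]_7) : 'M[R]_3 := \matrix_(i, j) sym3 (rowentry x) i j.

Definition metric_of_row (x : 'rV[R]_7) : 'M[R]_7 :=
  block_mx (sym_mx x) 0 0 ((rowentry x 6)%:M : 'M_4) : 'M_(3 + 4).

Definition row_of_metric (g : 'M[R]_7) : 'rV[R]_7 :=
  \row_j let ij := nth (0, 0)%N
      [:: (0, 0); (0, 1); (0, 2); (1, 1); (1, 2); (2, 2); (3, 3)]%N j in
    g (inord ij.1) (inord ij.2).

(* Sylvester's criterion for the leading 3x3 block, and positivity of the factor
   of the identity block. *)
Definition metric_domain : set 'rV[R]_7 := [set x : 'rV[R]_7 |
  [/\ 0 < rowentry x 0, 0 < rowentry x 0 * rowentry x 3 - rowentry x 1 * rowentry x 1,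
      0 < \det (sym_mx x) & 0 < rowentry x 6]].

Lemma metric_of_row_linear : linear metric_of_row.
Proof.
move=> t x y; rewrite /metric_of_row.
rewrite (@scale_block_mx _ 3 4 3 4) (@add_block_mx _ 3 4 3 4) !scaler0 !addr0.
rewrite scale_scalar_mx -raddfD /=.
have -> : rowentry (t *: x + y) 6 = t * rowentry x 6 + rowentry y 6 by rewrite /rowentry !mxE.
congr (block_mx _ _ _ _ : 'M_(3 + 4)); apply/matrixP => i j; rewrite !mxE.
by case: i => [[|[|[|//]]] ?]; case: j => [[|[|[|//]]] ?]; rewrite /= /rowentry !mxE.
Qed.

Lemma row_of_metricK : cancel metric_of_row row_of_metric.
Proof.
have El i : (i < 3)%N -> inord i = lshift 4 (inord i : 'I_3) :> 'I_7.
  by move=> i3; apply: val_inj; rewrite /= !inordK // (leq_trans i3).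
have Er : inord 3 = rshift 3 (0 : 'I_4) :> 'I_7 by apply: val_inj; rewrite /= !inordK.
move=> x; apply/rowP => j; rewrite mxE.
have xj k (hk : (k < 7)%N) : x 0 (Ordinal hk) = rowentry x k.
  by congr (x 0 _); apply: val_inj; rewrite /= inordK.
case: j => [[|[|[|[|[|[|[|//]]]]]]] hj]; rewrite xj /= ?Er ?El //
  /metric_of_row ?(@block_mxEul _ 3 4 3 4) ?(@block_mxEdr _ 3 4 3 4) mxE ?inordK //.
Qed.

Lemma continuous_rowentry i : continuous (fun x => rowentry x i).
Proof. exact: coord_continuous. Qed.

Lemma continuous_row_of_metric : continuous row_of_metric.
Proof. by apply: continuous_row => j; exact: coord_continuous. Qed.

Lemma open_metric_domain : open metric_domain.
Proof.
have O (f : 'rV[R]_7 -> R) : continuous f -> open [set x | 0 < f x].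
  move=> fc; apply: (open_comp (f := f) (D := [set t | 0 < t])); last exact: open_gt.
  by move=> x _; exact: fc.
have -> : metric_domain = [set x | 0 < rowentry x 0] `&`
    [set x | 0 < rowentry x 0 * rowentry x 3 - rowentry x 1 * rowentry x 1] `&`
    [set x | 0 < \det (sym_mx x)] `&` [set x | 0 < rowentry x 6].
  by apply/seteqP; split=> x; rewrite /metric_domain /=; [case|case=> [[[]]]].
have rc := continuous_rowentry.
apply: openI; last exact: O.
apply: openI; last first.
  apply: O; apply: continuous_det3 => i j.
  rewrite (_ : (fun x => _) = fun x : 'rV[R]_7 => sym3 (rowentry x) i j).
    by case: i => [[|[|[|//]]] ?]; case: j => [[|[|[|//]]] ?]; exact: rc.
  by apply/funext => x; rewrite mxE.
apply: openI; apply: O; first exact: rc.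
by apply: continuous_sub; exact: continuous_mul.
Qed.

Lemma posdef_mx_ul m n (A : 'M[R]_m) B C (D : 'M[R]_n) :
  posdef_mx (block_mx A B C D) -> posdef_mx A.
Proof.
move=> ABp x x0; have /ABp : row_mx x 0 != 0 :> 'rV_(m + n).
  by apply: contra x0 => /eqP/(congr1 lsubmx); rewrite row_mxKl linear0 => ->.
by rewrite mul_row_block !mul0mx !addr0 tr_row_mx mul_row_col trmx0 mulmx0 addr0.
Qed.

Lemma posdef_minor2 (S : 'M[R]_3) : S^T = S -> posdef_mx S ->
  0 < S 0 0 * S 1 1 - S 0 1 * S 0 1.
Proof.
move=> ST Sp; have SE i j : S i j = S j i by rewrite -{1}ST mxE.
have S0 := posdef_mx_diag 0 Sp.
(* On this vector the quadratic form equals [S 0 0] times the minor. *)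
pose v : 'rV[R]_3 := \row_j nth 0 [:: - S 0 1; S 0 0; 0] j.
have v0 : v != 0.
  by apply/eqP => /rowP/(_ 1); rewrite !mxE /= => S00; rewrite S00 ltxx in S0.
rewrite -(pmulr_rgt0 _ S0); apply: (lt_le_trans (Sp v v0)).
rewrite !mxE !big_ord_recl !big_ord0 !mxE !big_ord_recl !big_ord0 !mxE /=.
have -> : lift ord0 ord0 = 1 :> 'I_3 by exact: val_inj.
rewrite -[ord0]/(0 : 'I_3) (SE 1 0) le_eqVlt; apply/orP; left; apply/eqP; ring.
Qed.

Lemma sym3_cholesky (x : nat -> R) :
  0 < x 0%N -> 0 < x 0%N * x 3%N - x 1%N * x 1%N ->
  0 < \det (\matrix_(i < 3, j < 3) sym3 x i j) ->
  exists2 U : 'M[R]_3, U^T *m U = \matrix_(i, j) sym3 x i j & 0 < \det U.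
Proof.
rewrite det3E /mxentry !mxE !inordK //=.
set x0 := x 0%N; set x1 := x 1%N; set x2 := x 2%N; set x3 := x 3%N; set x4 := x 4%N.
set x5 := x 5%N; set m := x0 * x3 - _; set d := _ + _ => x0p mp dp.
(* The diagonal of the triangular factor: square roots of the quotients of successive leading minors
   [x0], [m] and [d]. *)
pose u := Num.sqrt x0; pose v := Num.sqrt (m / x0); pose z := Num.sqrt (d / m).
have up : 0 < u by rewrite sqrtr_gt0.
have vp : 0 < v by rewrite sqrtr_gt0 divr_gt0.
have zp : 0 < z by rewrite sqrtr_gt0 divr_gt0.
have u2 : x0 = u ^+ 2 by rewrite sqr_sqrtr // ltW.
have v2 : x3 = v ^+ 2 + (x1 / u) ^+ 2.
  rewrite sqr_sqrtr ?ltW ?divr_gt0 // exprMn exprVn -u2 /m; field.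
  by rewrite gt_eqF.
pose w := (x4 - x1 / u * (x2 / u)) / v.
have z2 : x5 = z ^+ 2 + w ^+ 2 + (x2 / u) ^+ 2.
  rewrite /w [z ^+ 2]sqr_sqrtr ?ltW ?divr_gt0 // /d /m.
  have m' : v ^+ 2 * u ^+ 2 != 0 by rewrite mulf_neq0 // expf_neq0 // gt_eqF.
  (* Rewriting the minor in terms of [u] and [v] leaves only denominators known to be nonzero. *)
  have -> : x0 * x3 - x1 * x1 = v ^+ 2 * u ^+ 2 by rewrite v2 u2; field; rewrite gt_eqF.
  rewrite v2 u2; field; by rewrite !gt_eqF.
have w2 : x4 = v * w + x1 / u * (x2 / u).
  by rewrite /w; field; rewrite !gt_eqF.
pose f (i j : nat) : R := match i, j with
  | 0, 0 => u | 0, 1 => x1 / u | 0, 2 => x2 / u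
  | 1, 1 => v | 1, 2 => w | 2, 2 => z | _, _ => 0 end.
exists (\matrix_(i, j) f i j); last first.
  rewrite det3E /mxentry !mxE !inordK //=.
  by rewrite !(mul0r, mulr0, subr0, addr0) !mulr_gt0.
have x1E : x1 = u * (x1 / u) by field; rewrite gt_eqF.
have x2E : x2 = u * (x2 / u) by field; rewrite gt_eqF.
apply/matrixP => i j; rewrite !mxE !big_ord_recl big_ord0 !mxE.
case: i => [[|[|[|//]]] ?]; case: j => [[|[|[|//]]] ?] /=;
  rewrite -/x0 -/x1 -/x2 -/x3 -/x4 -/x5.
- by rewrite u2; ring.
- by rewrite [RHS]x1E; ring.
- by rewrite [RHS]x2E; ring.
- by rewrite [RHS]x1E; ring.
- by rewrite [RHS]v2; ring.
- by rewrite [RHS]w2; ring.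
- by rewrite [RHS]x2E; ring.
- by rewrite [RHS]w2; ring.
- by rewrite [RHS]z2; ring.
Qed.

Lemma sym_gramE (S : 'M[R]_3) : S^T = S ->
  S = \matrix_(i, j) sym3 (fun n => nth 0 [:: S 0 0; S 0 1; S 0 2; S 1 1; S 1 2; S 2 2] n) i j.
Proof.
move=> ST; have SE i j : S i j = S j i by rewrite -{1}ST mxE.
apply/matrixP => i j; rewrite mxE.
case: i => [[|[|[|//]]] ?]; case: j => [[|[|[|//]]] ?] //=;
  first [congr (S _ _); exact: val_inj | rewrite SE; congr (S _ _); exact: val_inj].
Qed.

Lemma metric_of_row_eq (S : 'M[R]_3) (t : R) : S^T = S ->
  exists2 x, metric_of_row x = block_mx S 0 0 (t%:M : 'M_4) :> 'M_(3 + 4) &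
    [/\ sym_mx x = S, rowentry x 0 = S 0 0, rowentry x 1 = S 0 1,
        rowentry x 3 = S 1 1 & rowentry x 6 = t].
Proof.
move=> ST; pose s := [:: S 0 0; S 0 1; S 0 2; S 1 1; S 1 2; S 2 2; t].
pose x : 'rV[R]_7 := \row_j nth 0 s j.
have xE k : (k < 7)%N -> rowentry x k = nth 0 s k by move=> k7; rewrite /rowentry mxE inordK.
have SE : sym_mx x = S.
  rewrite [RHS]sym_gramE //; apply/matrixP => i j; rewrite !mxE.
  by case: i => [[|[|[|//]]] ?]; case: j => [[|[|[|//]]] ?]; rewrite /= xE.
exists x; first by rewrite /metric_of_row SE xE.
by split; rewrite ?xE.
Qed.

Lemma G2_metric_image :
  @G2_metric R @` @invariant_G2_structures R = metric_of_row @` metric_domain.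
Proof.
apply/seteqP; split=> [_ [phi /invariant_G2_structureE[a [M [-> aM]]] <-]|_ [x xD <-]].
  have [_ gp _] := G2_metric_inner_product aM.
  move: gp; rewrite G2_metric_formE //; set c := _ / _.
  rewrite (@scale_block_mx _ 3 4 3 4) !scaler0 scale_scalar_mx.
  set S := c *: _; set t := c * _ => gp.
  have Sp : posdef_mx S by exact: (@posdef_mx_ul 3 4 _ _ _ _ gp).
  have ST : S^T = S by rewrite /S linearZ /= trmx_mul trmxK.
  have [x xE [xS x0 x1 x3 x6]] := metric_of_row_eq t ST.
  exists x => //; split; rewrite ?xS ?x0 ?x1 ?x3 ?x6.
  - exact: posdef_mx_diag.
  - exact: posdef_minor2.
  - rewrite /S detZ det_mulmx det_tr mulr_gt0 //; last first.
      by rewrite -expr2 exprn_even_gt0 //=; apply: contraTneq aM => ->; rewrite mulr0 ltxx.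
    (* The factor [c] is a quotient of squares, and it cannot vanish because [S] has positive
       diagonal entries. *)
    rewrite exprn_gt0 // lt0r divr_ge0 ?sqr_ge0 // andbT.
    apply: contraTneq (posdef_mx_diag 0 Sp) => c0.
    by rewrite /S c0 scale0r mxE ltxx.
  - by have := posdef_mx_diag (rshift 3 (0 : 'I_4)) gp;
      rewrite (@block_mxEdr _ 3 4 3 4) mxE eqxx mulr1n.
case: xD => x0 x1 x2 t0.
have [U UU Up] := sym3_cholesky x0 x1 x2.
set t := rowentry x 6 in t0 *.
(* With M = t U and a^3 = det U one gets det M = (t a)^3, so the conformal factor
   of the metric is t^-2. *)
pose a := oddroot 3 (\det U).
have a3 : a ^+ 3 = \det U by exact: oddrootK.
have a0 : 0 < a by rewrite -(@exprn_odd_gt0 _ 3) // a3.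
have dM : \det (t *: U) = (t * a) ^+ 3 by rewrite detZ exprMn a3.
have aM : 0 < a * \det (t *: U) by rewrite dM mulr_gt0 // exprn_gt0 // mulr_gt0.
exists (G2_form a (t *: U)); first by apply/invariant_G2_structureE; exists a, (t *: U).
rewrite G2_metric_formE // dM oddrootX //.
rewrite (@scale_block_mx _ 3 4 3 4) !scaler0 scale_scalar_mx.
have -> : (t *: U)^T *m (t *: U) = (t * t) *: sym_mx x.
  by rewrite [(t *: U)^T]linearZ -scalemxAl -scalemxAr UU scalerA.
rewrite scalerA.
have -> : a ^+ 2 / (t * a) ^+ 2 * (t * t) = 1 by field; rewrite !gt_eqF.
have -> : a ^+ 2 / (t * a) ^+ 2 * ((t * a) ^+ 3 / a ^+ 3) = t by field; rewrite !gt_eqF.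
by rewrite scale1r.
Qed.

Lemma invariant_metrics_manifold :
  has_manifold_dim (@G2_metric R @` @invariant_G2_structures R) 7.
Proof.
rewrite G2_metric_image.
apply: (linear_image_manifold metric_of_row_linear continuous_row_of_metric
  row_of_metricK open_metric_domain).
have d1 : 0 < 1 * \det (1%:M : 'M[R]_3) by rewrite det1 mul1r.
have : (@G2_metric R @` @invariant_G2_structures R) !=set0.
  exists (G2_metric (G2_form 1 1%:M)), (G2_form 1 1%:M) => //.
  by apply/invariant_G2_structureE; exists 1, 1%:M.
by rewrite G2_metric_image => -[_ [x xO _]]; exists x.
Qed.

End MetricManifold.

Theorem lemma1p1 (R : realType) :
  [/\ forall phi : kform (pspace R) 3,
        G2_structure phi /\ Ad_invariant phi <->
        exists (a : R) (Dinv : 'M[R]_3),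
          phi = G2_form a Dinv /\ 0 < a * \det Dinv,
      forall (a : R) (Dinv : 'M[R]_3), 0 < a * \det Dinv ->
        let D := invmx Dinv in
        invariant_inner_product (G2_metric (G2_form a Dinv)) /\
        G2_metric (G2_form a Dinv) =
          (a ^+ 2 / oddroot 3 (\det Dinv) ^+ 2) *:
            block_mx (invmx (D *m D^T)) 0
                     0 ((\det Dinv / a ^+ 3)%:M : 'M[R]_4),
      (forall (a : R) (Dinv : 'M[R]_3), 0 < a * \det Dinv ->
        forall b : 'I_7 -> pspace R, is_vbasis b ->
          G2_oriented (G2_form a Dinv) b <-> 0 < a * \det (coord_mx b)) /\
      (forall a : R, a != 0 <-> exists Dinv : 'M[R]_3, 0 < a * \det Dinv),
      has_manifold_dim (@kform_components R 3 @` @invariant_G2_structures R) 10 &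
      has_manifold_dim (@G2_metric R @` @invariant_G2_structures R) 7].
Proof.
split.
- exact: invariant_G2_structureE.
- move=> a M aM D; split; first exact: G2_metric_inner_product.
  rewrite /D invmx_gramV ?G2_metric_formE // unitmxE unitfE.
  by apply: contraTneq aM => ->; rewrite mulr0 ltxx.
- split=> [a M aM b bb|a]; first exact: G2_oriented_formE.
  split=> [a0|[M aM]]; last by apply: contraTneq aM => ->; rewrite mul0r ltxx.
  (* The determinant of this scalar matrix is [a ^+ 3], so the product is [a ^+ 4]. *)
  by exists a%:M; rewrite det_scalar -exprS exprn_even_gt0.
- exact: invariant_forms_manifold.
- exact: invariant_metrics_manifold.
Qed.
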